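(* Let $\mathcal{P}$ be a family of probability distributions on a common measurable space, let $n\ge 1$, and let $P_1,\dots,P_n\in\mathcal{P}$ (not necessarily distinct). Let $\mathbb{P}_n=\mathbb{E}_{\pi\sim\mathrm{Unif}(S_n)}\left[\otimes_{i=1}^n P_{\pi(i)}\right]$ and $\mathbb{Q}_n=\left(\frac1n\sum_{i=1}^n P_i\right)^{\otimes n}$. Then the following upper bounds hold: 1. If $\mathsf{C}_{\chi^2}(\mathcal{P})<\infty$, then $$\chi^2(\mathbb{P}_n\|\mathbb{Q}_n)\le 10\sum_{\ell=2}^n \mathsf{C}_{\chi^2}(\mathcal{P})^\ell .$$ 2. If $\mathsf{\Delta}_{H^2}(\mathcal{P})<\infty$ and $\mathsf{C}_{\chi^2}(\mathcal{P})<\infty$, then $$\chi^2(\mathbb{P}_n\|\mathbb{Q}_n)\le \left(e\,\mathsf{\Delta}_{H^2}(\mathcal{P})\right)^{\mathsf{C}_{\chi^2}(\mathcal{P})}-1 .$$ 3. If $\mathsf{D}_{\chi^2}(\mathcal{P})<\infty$, then $$\chi^2(\mathbb{P}_n\|\mathbb{Q}_n)\le \left(1+\mathsf{D}_{\chi^2}(\mathcal{P})\right)^{1+\mathsf{C}_{\chi^2}(\mathcal{P})}-1 .$$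
   Context: $S_n$ is the permutation group of $[n]=\{1,\dots,n\}$ and $\mathrm{Unif}$ denotes the uniform distribution. For probability measures $P,Q$ on the same space, $\chi^2(P\|Q)=\int\frac{(\mathrm{d}P-\mathrm{d}Q)^2}{\mathrm{d}Q}$ ($=+\infty$ if $P\not\ll Q$) and $H^2(P,Q)=\int(\sqrt{\mathrm{d}P}-\sqrt{\mathrm{d}Q})^2\in[0,2]$. For a family $\mathcal{P}$ of probability distributions on the same space: - $\chi^2$ channel capacity: $\mathsf{C}_{\chi^2}(\mathcal{P})=\sup_{\rho}\mathbb{E}_{P\sim\rho}\left[\chi^2\left(P\,\|\,\mathbb{E}_{P'\sim\rho}[P']\right)\right]$, where $\rho$ ranges over all probability distributions (priors) on $\mathcal{P}$ and $\mathbb{E}_{P'\sim\rho}[P']$ is the mixture distribution; - $\chi^2$ diameter: $\mathsf{D}_{\chi^2}(\mathcal{P})=\sup_{P_1,P_2\in\mathcal{P}}\chi^2(P_1\|P_2)$; - $H^2$ diameter: $\mathsf{D}_{H^2}(\mathcal{P})=\sup_{P_1,P_2\in\mathcal{P}}H^2(P_1,P_2)$; - maximum $H^2$ singularity: $\mathsf{\Delta}_{H^2}(\mathcal{P})=\left(1-\frac{\mathsf{D}_{H^2}(\mathcal{P})}{2}\right)^{-2}$ ($=+\infty$ if $\mathsf{D}_{H^2}(\mathcal{P})=2$). *)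

(* Defs.v *)
From HB Require Import structures.
From mathcomp Require Import all_boot all_order all_fingroup all_algebra.
From mathcomp Require Import all_classical all_reals all_analysis.
From mathcomp Require Import measurable_realfun.

Set Implicit Arguments.
Unset Strict Implicit.
Unset Printing Implicit Defensive.

Import Order.TTheory GRing.Theory Num.Theory.

Local Open Scope classical_set_scope.
Local Open Scope ring_scope.
Local Open Scope ereal_scope.
Local Open Scope charge_scope.

Section uniform_mixture.
Context d (T : measurableType d) (R : realType) (I : finType).

(* The law of a sample from P_i with i ~ Unif(I). The witness i0 only records
   that I is nonempty; the value does not depend on it. *)
Definition unif_mix (i0 : I) (P : I -> probability T R) : set T -> \bar R :=
  fun A => (#|I|%:R^-1)%:E * \sum_(i : I) P i A.

Variables (i0 : I) (P : I -> probability T R).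

Let unif_mix0 : unif_mix i0 P set0 = 0.
Proof. by rewrite /unif_mix big1 ?mule0. Qed.

Let unif_mix_ge0 A : 0 <= unif_mix i0 P A.
Proof. by rewrite mule_ge0 ?lee_fin ?invr_ge0// sume_ge0. Qed.

Let unif_mix_sigma_additive : semi_sigma_additive (unif_mix i0 P).
Proof.
move=> F mF tF mUF; rewrite [X in X @ _ --> _](_ : _ = (fun n =>
    (#|I|%:R^-1)%:E * \sum_(0 <= k < n) \sum_(i : I) P i (F k))); last first.
  by apply/funext => n; rewrite ge0_sume_distrr// => k _; exact: sume_ge0.
apply: cvgeZl => //.
rewrite [X in _ --> X](_ : _ =
    lim ((fun n => \sum_(0 <= k < n) \sum_(i : I) P i (F k)) @ \oo)).
  by apply: is_cvg_ereal_nneg_natsum => k _; exact: sume_ge0.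
rewrite nneseries_sum//; apply: eq_bigr => /= i _.
exact: measure_semi_bigcup.
Qed.

HB.instance Definition _ := isMeasure.Build _ _ _ (unif_mix i0 P)
  unif_mix0 unif_mix_ge0 unif_mix_sigma_additive.

Let unif_mix_setT : unif_mix i0 P [set: T] = 1.
Proof.
rewrite /unif_mix (eq_bigr (fun=> 1)); last by move=> i _; exact: probability_setT.
rewrite sumEFin sumr_const -EFinM mulVf// pnatr_eq0 -lt0n.
by apply/card_gt0P; exists i0.
Qed.

HB.instance Definition _ := Measure_isProbability.Build _ _ _ (unif_mix i0 P)
  unif_mix_setT.

End uniform_mixture.

Section product_probability2.
Context d1 d2 (T1 : measurableType d1) (T2 : measurableType d2) (R : realType).
Variables (P : probability T1 R) (Q : probability T2 R).

Definition product_prob2 : set (T1 * T2) -> \bar R := P \x Q.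

HB.instance Definition _ := Measure.on product_prob2.

Let product_prob2_setT : product_prob2 [set: T1 * T2] = 1.
Proof.
rewrite /product_prob2 -setXTT product_measure1E// -[RHS]mule1.
by congr (_ * _); exact: probability_setT.
Qed.

HB.instance Definition _ := Measure_isProbability.Build _ _ _ product_prob2
  product_prob2_setT.

End product_probability2.

Section product_probability.
Context d (T : measurableType d) (R : realType).

Definition tuple_cons n (x : T * n.-tuple T) : n.+1.-tuple T :=
  [the n.+1.-tuple T of x.1 :: x.2].

Lemma measurable_tuple_cons n :
  measurable_fun [set: T * n.-tuple T] (@tuple_cons n).
Proof. exact: measurable_cons. Qed.

HB.instance Definition _ n := isMeasurableFun.Build _ _ _ _ (@tuple_cons n)
  (@measurable_tuple_cons n).

(* P_0 (x) ... (x) P_{n-1} on T^n, as the law of (x_0, (x_1, ..., x_{n-1})) *)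
Fixpoint product_prob n : ('I_n -> probability T R) -> probability (n.-tuple T) R :=
  match n with
  | 0 => fun=> \d_([tuple] : 0.-tuple T)
  | m.+1 => fun P => distribution
      (product_prob2 (P ord0) (product_prob (fun i => P (lift ord0 i))))
      (@tuple_cons m)
  end.

Lemma product_prob_box n (P : 'I_n -> probability T R) (A : 'I_n -> set T) :
  (forall i, measurable (A i)) ->
  product_prob P [set t | forall i, A i (tnth t i)] = \prod_(i < n) P i (A i).
Proof.
elim: n P A => [|n IH] P A mA.
  by rewrite big_ord0/= diracE mem_set// => -[].
rewrite big_ord_recl /= /distribution /pushforward -IH; last by move=> i.
rewrite -product_measure1E//; last first.
  rewrite (_ : [set t | _] =
      \bigcap_(i in [set: 'I_n]) ((fun t => tnth t i) @^-1` A (lift ord0 i))).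
    apply: fin_bigcap_measurable => // i _; rewrite -[X in measurable X]setTI.
    by apply: measurable_tnth.
  by apply/seteqP; split => [t At i _|t At i]; [exact: At|exact: (At i)].
congr product_measure1.
apply/seteqP; split => -[x t]/= xt.
  split; first by have := xt ord0; rewrite tnth0.
  by move=> i; have := xt (lift ord0 i); rewrite tnthS.
case: xt => Ax At i.
by case: (unliftP ord0 i) => [j|] ->; rewrite ?tnthS ?tnth0//; exact: At.
Qed.

End product_probability.

Section divergences.
Context d (T : measurableType d) (R : realType).
Implicit Types P Q : probability T R.

Definition chi2 P Q : \bar R :=
  if `[< P `<< Q >]
  then \int[Q]_x (('d (charge_of_finite_measure P) '/d Q) x - 1) ^+ 2
  else +oo.

(* The value does not depend on the dominating measure with respect to which
   the densities are taken; (P + Q) / 2 is used. *)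
Definition hellinger2 P Q : \bar R :=
  let mu := unif_mix true (fun b : bool => if b then P else Q) in
  let p := 'd (charge_of_finite_measure P) '/d mu in
  let q := 'd (charge_of_finite_measure Q) '/d mu in
  \int[mu]_x ((Num.sqrt (fine (p x)) - Num.sqrt (fine (q x))) ^+ 2)%:E.

End divergences.

Section prior_mixture.
Context d (T : measurableType d) (R : realType).

Lemma measurable_prob_ev (A : set T) : measurable A ->
  measurable_fun [set: pprobability T R] (fun P => (P : probability T R) A).
Proof.
exact: (measurable_kernel (kprobability (@measurable_id _ (pprobability T R) setT))).
Qed.

Variable rho : probability (pprobability T R) R.

Definition prior_mix : set T -> \bar R :=
  fun A => \int[rho]_P (P : probability T R) A.

Let prior_mix0 : prior_mix set0 = 0.
Proof. by rewrite /prior_mix integral0_eq. Qed.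

Let prior_mix_ge0 A : 0 <= prior_mix A.
Proof. by apply: integral_ge0 => P _; exact: measure_ge0. Qed.

Let prior_mix_sigma_additive : semi_sigma_additive prior_mix.
Proof.
move=> F mF tF _; rewrite [X in _ --> X](_ : _ =
    \int[rho]_P \sum_(0 <= k <oo) (P : probability T R) (F k)); last first.
  apply: eq_integral => P _.
  by apply/esym/cvg_lim => //; exact: measure_sigma_additive.
rewrite [X in X @ _](_ : _ =
    (fun n => \int[rho]_P \sum_(0 <= i < n) (P : probability T R) (F i))); last first.
  apply/funext => n; rewrite -ge0_integral_sum//.
  by move=> ?; exact: measurable_prob_ev.
apply: cvg_monotone_convergence => //.
- by move=> n; apply: emeasurable_sum => m; exact: measurable_prob_ev.
- by move=> n x _; rewrite sume_ge0.
- by move=> x _ m n mn; exact: ereal_nondecreasing_series.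
Qed.

HB.instance Definition _ := isMeasure.Build _ _ _ prior_mix
  prior_mix0 prior_mix_ge0 prior_mix_sigma_additive.

Let prior_mix_setT : prior_mix [set: T] = 1.
Proof.
rewrite /prior_mix (eq_integral (fun=> 1)); last first.
  by move=> P _; exact: probability_setT.
by rewrite integral_cst// mul1e; exact: probability_setT.
Qed.

HB.instance Definition _ := Measure_isProbability.Build _ _ _ prior_mix
  prior_mix_setT.

End prior_mixture.

Section family.
Context d (T : measurableType d) (R : realType).
Implicit Type F : set (probability T R).

(* Probability distributions on F: F need not be measurable for the
   sigma-algebra generated by the evaluations P |-> P A, and those giving F
   outer measure 1 are exactly the extensions of the probability measures on F
   with the trace sigma-algebra. *)
Definition prior F : set (probability (pprobability T R) R) :=
  [set rho | forall A : set (pprobability T R),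
     measurable A -> F `<=` A -> rho A = 1].

(* When the sigma-algebra of T is not countably generated, P |-> chi2 P Q may
   fail to be measurable; the integral is then the lower integral. *)
Definition chi2_capacity F : \bar R :=
  ereal_sup [set \int[rho]_P chi2 P (prior_mix rho) | rho in prior F].

Definition chi2_diameter F : \bar R :=
  ereal_sup [set chi2 PQ.1 PQ.2 | PQ in F `*` F].

Definition hellinger2_diameter F : \bar R :=
  ereal_sup [set hellinger2 PQ.1 PQ.2 | PQ in F `*` F].

(* In the extended reals 0^-1 = +oo, so this is +oo when the diameter is 2. *)
Definition hellinger2_singularity F : \bar R :=
  ((1 - hellinger2_diameter F / 2%:E)^-1) ^+ 2.

End family.

Section permutation_mixture.
Context d (T : measurableType d) (R : realType) (n : nat).
Variable P : 'I_n -> probability T R.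

Definition perm_mixture : probability (n.-tuple T) R :=
  unif_mix (1%g : 'S_n) (fun s => product_prob (fun i => P (s i))).

Definition iid_mixture (n_gt0 : (0 < n)%N) : probability (n.-tuple T) R :=
  product_prob (fun _ : 'I_n => unif_mix (Ordinal n_gt0) P).

End permutation_mixture.

(* Main.v *)
Require Import Defs.
From mathcomp Require Import all_boot all_order all_fingroup all_algebra.
From mathcomp Require Import all_classical all_reals all_analysis.
From mathcomp Require Import ring lra measurable_realfun.
From mathcomp Require mpoly.
Import -(notations) mpoly.

(* Let f_i be the density of P_i with respect to the average Q of the P_i, and
   a_ij = int f_i f_j dQ = 1 + n B_ij. Expanding the square of the density of
   the permutation mixture, 1 + chi^2 = per(a) / n!, where B is positive
   semidefinite with zero row sums and its trace, the average of chi^2(P_i || Q),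
   is at most the capacity.
   The permanent of a Gram matrix is the squared Fischer (Bombieri) norm of a
   product of linear forms l_1 ... l_n. By an AM-GM inequality for this norm,
   replacing l_1, ..., l_n by n independent uniform choices among them does not
   decrease the average, and by Newton's identities the resulting average is the
   complete homogeneous symmetric polynomial h_n of the spectrum of 1/n + B.
   Since 1 is an eigenvalue, h_n is the sum of the h_l of the spectrum of B over
   l <= n. If this spectrum is bounded by r, then h_l is at most the coefficient
   of t^l in (1 - r t)^(- tr B / r). For the second and third bounds a lower
   bound d on all a_ij provides r = 1 - d (Doeblin minorization), and d comes
   from the Hellinger or chi^2 diameter. For the first bound, one uses r = tr B;
   the linear term is removed because per(1 + n s B) / n! - 1 is a polynomial
   in s with nonnegative coefficients starting in degree 2, so that scaling B
   up to a constant trace gains a factor s^2. *)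

Set Implicit Arguments.
Unset Strict Implicit.
Unset Printing Implicit Defensive.

Import Order.TTheory GRing.Theory Num.Theory.

Local Open Scope ring_scope.

(** * The Fischer inner product on polynomials and its smoothing inequality *)

Section fischer.
Variables (R : realFieldType) (r : nat).
Implicit Types (p q W : mpoly r R) (u v : 'I_r -> R).

(** This is p(D) q at the origin: monomials are orthogonal and X^m has squared norm m!. Monomials
    outside the support of [q] would contribute zero. *)
Definition fischer p q : R :=
  \sum_(m <- msupp q) (\prod_i (m i)`!)%:R * mcoeff m p * mcoeff m q.

Lemma fischerC p q : fischer p q = fischer q p.
Proof.
have H (a b : mpoly r R) : fischer a b =
    \sum_(m <- [seq m <- msupp b | m \in msupp a])
      (\prod_i (m i)`!)%:R * mcoeff m a * mcoeff m b.
  rewrite big_filter [RHS]big_mkcond; apply: eq_bigr => m _.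
  by case: ifPn => // /memN_msupp_eq0 ->; rewrite mulr0 mul0r.
rewrite !H (perm_big [seq m <- msupp p | m \in msupp q]) /=.
  by apply: eq_bigr => m _; rewrite mulrAC.
rewrite uniq_perm ?filter_uniq ?msupp_uniq// => m.
by rewrite !mem_filter andbC.
Qed.

Lemma fischerDl p1 p2 q : fischer (p1 + p2) q = fischer p1 q + fischer p2 q.
Proof.
rewrite -big_split; apply: eq_bigr => m _ /=.
by rewrite mcoeffD mulrDr mulrDl.
Qed.

Lemma fischerZl c p q : fischer (c *: p) q = c * fischer p q.
Proof.
rewrite mulr_sumr; apply: eq_bigr => m _ /=.
by rewrite mcoeffZ mulrCA !mulrA.
Qed.

Lemma fischerDr p q1 q2 : fischer p (q1 + q2) = fischer p q1 + fischer p q2.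
Proof. by rewrite fischerC fischerDl !(fischerC _ p). Qed.

Lemma fischerZr c p q : fischer p (c *: q) = c * fischer p q.
Proof. by rewrite fischerC fischerZl (fischerC p). Qed.

Lemma fischer_suml (I : Type) (s : seq I) (F : I -> mpoly r R) q :
  fischer (\sum_(i <- s) F i) q = \sum_(i <- s) fischer (F i) q.
Proof.
apply: (big_morph (fischer^~ q)) => [x y|]; first exact: fischerDl.
by rewrite -(scale0r 0) fischerZl mul0r.
Qed.

Lemma fischer_sumr (I : Type) (s : seq I) (F : I -> mpoly r R) p :
  fischer p (\sum_(i <- s) F i) = \sum_(i <- s) fischer p (F i).
Proof.
rewrite fischerC fischer_suml; apply: eq_bigr => i _; exact: fischerC.
Qed.

Lemma fischer_ge0 p : 0 <= fischer p p.
Proof.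
apply: sumr_ge0 => m _; rewrite -mulrA -expr2 mulr_ge0 ?sqr_ge0//.
Qed.

Lemma fischer1 : fischer 1 1 = 1.
Proof.
rewrite /fischer msupp1 big_seq1 !mcoeff1 eqxx !mulr1.
by rewrite big1// => i _; rewrite mnm0E.
Qed.

Lemma fischerX m q :
  fischer (mpolyX R m) q = (\prod_i (m i)`!)%:R * mcoeff m q.
Proof.
rewrite /fischer; have [mq|mq] := boolP (m \in msupp q).
  rewrite (bigD1_seq m) ?msupp_uniq//= mcoeffX eqxx mulr1.
  rewrite [X in _ + X]big1 ?addr0// => i.
  by rewrite mcoeffX eq_sym => /negPf ->; rewrite mulr0 mul0r.
rewrite (memN_msupp_eq0 mq) mulr0 big_seq big1// => i iq.
rewrite mcoeffX; case: eqP iq => [<-|]; first by rewrite (negPf mq).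
by rewrite mulr0 mul0r.
Qed.

(** By linearity [p] may be a monomial X^m, where the claim is (m + e_k)! = (m_k + 1) m!. *)
Lemma fischer_adjX k p q :
  fischer (mpolyX R (mnm1 k) * p) q = fischer p (mderiv k q).
Proof.
rewrite {1}[p]mpolyE mulr_sumr [in RHS](mpolyE p) !fischer_suml.
apply: eq_bigr => m _; rewrite -scalerAr !fischerZl; congr (_ * _).
rewrite -mpolyXD !fischerX mcoeff_deriv addmC -(mulr_natl (mcoeff _ q)) mulrA -natrM.
congr (_%:R * _); rewrite (bigD1 k)//= [in RHS](bigD1 k)//=.
rewrite mnmDE mnm1E eqxx addn1 factS mulnC [RHS]mulnAC [RHS]mulnC.
congr (_ * _)%N; last by rewrite mulnC.
apply: eq_bigr => i ik.
by rewrite mnmDE mnm1E eq_sym (negPf ik) addn0.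
Qed.

Definition lform u : mpoly r R := \sum_k u k *: mpolyX R (mnm1 k).
Definition dderiv u p : mpoly r R := \sum_k u k *: mderiv k p.
Definition dotv u v : R := \sum_k u k * v k.

Lemma fischer_adj u p q : fischer (lform u * p) q = fischer p (dderiv u q).
Proof.
rewrite mulr_suml fischer_suml fischer_sumr; apply: eq_bigr => k _.
by rewrite -scalerAl fischerZl fischerZr fischer_adjX.
Qed.

Lemma dderivM u p q : dderiv u (p * q) = dderiv u p * q + p * dderiv u q.
Proof.
rewrite mulr_suml mulr_sumr -big_split; apply: eq_bigr => k _ /=.
by rewrite mderivM scalerDr scalerAl -scalerAr.
Qed.

Lemma dderiv_lform u v : dderiv u (lform v) = (dotv u v)%:A.
Proof.
rewrite /dderiv /dotv scaler_suml; apply: eq_bigr => k _.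
rewrite /lform (raddf_sum (mderiv k)) /= (bigD1 k)//= big1 => [|i ik].
  by rewrite mderivZ mderivX mnm1E eqxx addr0 -[X in mnm_sub X _]add0m addmK
    mpolyX0 !scalerA mulr1.
by rewrite mderivZ mderivX mnm1E (negPf ik) scale0r scaler0.
Qed.

(* The commutation relation [D_u, M_v] = <u, v>. *)
Lemma dderiv_lformM u v p :
  dderiv u (lform v * p) = dotv u v *: p + lform v * dderiv u p.
Proof. by rewrite dderivM dderiv_lform -scalerAl mul1r. Qed.

Lemma dderiv1 u : dderiv u 1 = 0.
Proof.
by rewrite /dderiv big1// => k _; rewrite -mpolyC1 mderivC scaler0.
Qed.

(** Adjunction moves one factor to the other side as a derivation; the commutation relation splits
    it into a scalar term and a term to which adjunction applies again. *)
Lemma fischer_sqr u p :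
  fischer (lform u * (lform u * p)) (lform u * (lform u * p)) =
  dotv u u * fischer (lform u * p) (lform u * p) +
  fischer (dderiv u (lform u * p)) (dderiv u (lform u * p)).
Proof.
rewrite fischer_adj dderiv_lformM fischerDr fischerZr; congr (_ + _).
by rewrite fischerC fischer_adj.
Qed.

(** The two forms are exchanged in the second argument before the adjunction. The last term then
    pairs the same two polynomials whose squared norms appear in [fischer_sqr] for [u] and for
    [v]. *)
Lemma fischer_mul2 u v p :
  fischer (lform u * (lform v * p)) (lform u * (lform v * p)) =
  dotv u v * fischer (lform u * p) (lform v * p) +
  fischer (dderiv u (lform u * p)) (dderiv v (lform v * p)).
Proof.
rewrite [X in fischer _ X]mulrCA fischer_adj (dderiv_lformM u v).
rewrite fischerDr fischerZr.
congr (_ * _ + _); first by rewrite fischerC.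
by rewrite fischerC fischer_adj.
Qed.

Lemma fischer_sub_ge0 p q :
  0 <= fischer p p + fischer q q - 2 * fischer p q.
Proof.
have := fischer_ge0 (p - q).
rewrite -scaleN1r !(fischerDl, fischerDr, fischerZl, fischerZr) (fischerC q p).
by move=> h; lra.
Qed.

(* The analogue of 2 |xy|^2 <= |x^2|^2 + |y^2|^2 for the Fischer norm. *)
Lemma fischer_smoothing u v p :
  2 * fischer (lform u * (lform v * p)) (lform u * (lform v * p)) <=
  fischer (lform u * (lform u * p)) (lform u * (lform u * p)) +
  fischer (lform v * (lform v * p)) (lform v * (lform v * p)).
Proof.
rewrite !fischer_sqr fischer_mul2.
set a := fischer (lform u * p) (lform u * p); set b := fischer (lform v * p) _.
set c := fischer (lform u * p) (lform v * p).
have := fischer_sub_ge0 (dderiv u (lform u * p)) (dderiv v (lform v * p)).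
(* The derivative terms are covered by the previous inequality. What remains is the sum over k of
   the squared norms of [u k *: (lform u * p) - v k *: (lform v * p)]. *)
suff : 0 <= dotv u u * a + dotv v v * b - 2 * (dotv u v * c) by lra.
rewrite /dotv !mulr_suml mulr_sumr -big_split/= -sumrB; apply: sumr_ge0 => k _.
have := fischer_sub_ge0 (u k *: (lform u * p)) (v k *: (lform v * p)).
rewrite !(fischerZl, fischerZr) -/a -/b -/c; lra.
Qed.

End fischer.

(** * Permanents of Gram matrices as Fischer inner products *)

Section permanent.
Variable R : realFieldType.

Definition permanent n (M : 'I_n -> 'I_n -> R) : R :=
  \sum_(s : 'S_n) \prod_i M i (s i).

(** Laplace expansion along the first row: [lift_perm] encodes a permutation by the image of [ord0]
    and a permutation of the remaining points. *)
Lemma permanent_expand n (M : 'I_n.+1 -> 'I_n.+1 -> R) :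
  permanent M =
  \sum_j M ord0 j * permanent (fun i k => M (lift ord0 i) (lift j k)).
Proof.
pose h (js : 'I_n.+1 * 'S_n) := lift_perm ord0 js.1 js.2.
have hI : injective h.
  move=> [j s] [k t] /permP/= st.
  have jk : j = k by have := st ord0; rewrite /h !lift_perm_id.
  congr pair => //; apply/permP => i; have := st (lift ord0 i).
  by rewrite /h /= !lift_perm_lift jk => /lift_inj.
have hB : bijective h.
  by apply: inj_card_bij => //; rewrite card_prod card_ord !card_Sn factS.
rewrite /permanent (reindex h) /=; last exact: onW_bij.
under [RHS]eq_bigr do rewrite mulr_sumr.
rewrite pair_big /=; apply: eq_bigr => -[j s] _.
rewrite big_ord_recl lift_perm_id; congr (_ * _).
by apply: eq_bigr => i _; rewrite lift_perm_lift.
Qed.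

Variable r : nat.
Implicit Type w : 'I_r -> R.

Lemma dderiv_prod n w (b : 'I_n.+1 -> 'I_r -> R) :
  dderiv w (\prod_k lform (b k)) =
  \sum_j dotv w (b j) *: \prod_(k < n) lform (b (lift j k)).
Proof.
elim: n b => [|n IH] b.
  by rewrite !big_ord_recl !big_ord0 mulr1 addr0 dderiv_lform.
rewrite big_ord_recl dderiv_lformM IH [RHS]big_ord_recl; congr (_ + _).
rewrite mulr_sumr; apply: eq_bigr => j _.
rewrite -scalerAr [in RHS]big_ord_recl; congr (_ *: (lform (b _) * _)).
  by apply: val_inj.
apply: eq_bigr => k _; congr (lform (b _)); apply: val_inj.
by rewrite /= /bump /= !add1n ltnS addnS.
Qed.

(** Adjunction turns the first linear form into a derivation, and the Leibniz rule [dderiv_prod]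
    then reproduces the first-row expansion of the permanent. *)
Lemma fischer_prod n (a b : 'I_n -> 'I_r -> R) :
  fischer (\prod_k lform (a k)) (\prod_k lform (b k)) =
  permanent (fun i j => dotv (a i) (b j)).
Proof.
elim: n a b => [|n IH] a b.
  rewrite !big_ord0 fischer1 /permanent (big_pred1 1%g) ?big_ord0// => s.
  by apply/esym/eqP/permP => -[].
rewrite big_ord_recl fischer_adj dderiv_prod fischer_sumr permanent_expand.
by apply: eq_bigr => j _; rewrite fischerZr IH.
Qed.

End permanent.

(** * Reindexing of sums over functions *)

Section reindexing.
Variables (R : realFieldType) (T : finType).

Lemma sum_ffun_lift m (p : 'I_m.+1) (phi : T -> {ffun 'I_m -> T} -> R) :
  \sum_(g : {ffun 'I_m.+1 -> T}) phi (g p) [ffun x => g (lift p x)] =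
  \sum_k \sum_(g : {ffun 'I_m -> T}) phi k g.
Proof.
rewrite pair_big /=.
pose h (kg : T * {ffun 'I_m -> T}) : {ffun 'I_m.+1 -> T} :=
  [ffun x => if unlift p x is Some y then kg.2 y else kg.1].
rewrite (reindex h) /=; last first.
  exists (fun g => (g p, [ffun x => g (lift p x)])) => [[k g] _|g _].
    congr pair; first by rewrite ffunE unlift_none.
    by apply/ffunP => x; rewrite !ffunE liftK.
  apply/ffunP => x; rewrite ffunE.
  by case: unliftP => [y|] ->; rewrite ?ffunE.
apply: eq_bigr => -[k g] _; congr phi; first by rewrite ffunE unlift_none.
by apply/ffunP => x; rewrite !ffunE liftK.
Qed.

(** Exchanging [y] with the value of [g] at [K] is an involution on pairs (y, g); after it the
    summand no longer depends on [y]. *)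
Lemma sum_ffun_upd (I : finType) (K : I) (H : {ffun I -> T} -> R) :
  \sum_y \sum_(g : {ffun I -> T}) H [ffun x => if x == K then y else g x] =
  #|T|%:R * \sum_g H g.
Proof.
pose h (yg : T * {ffun I -> T}) : T * {ffun I -> T} :=
  (yg.2 K, [ffun x => if x == K then yg.1 else yg.2 x]).
have hK : involutive h.
  move=> [y g]; rewrite /h /= ffunE eqxx; congr pair.
  by apply/ffunP => x; rewrite !ffunE; case: eqP => [->|].
rewrite pair_big /= (reindex_inj (inv_inj hK)) /=.
rewrite (eq_bigr (fun yg : T * {ffun I -> T} => H yg.2)); last first.
  move=> [y g] _ /=; congr H; apply/ffunP => x; rewrite !ffunE /=.
  by case: eqP => [->|].
by rewrite -(pair_big xpredT xpredT (fun _ g => H g)) /= sumr_const mulr_natl.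
Qed.

End reindexing.

(** * Sampling without replacement against i.i.d. sampling *)

Section permanent_le_average.
Variables (R : realFieldType) (n r : nat) (V : 'I_n -> 'I_r -> R).

Definition fnorm m (g : 'I_m -> 'I_n) : R :=
  fischer (\prod_k lform (V (g k))) (\prod_k lform (V (g k))).

(** This is [fischer_smoothing] for the factors at [x] and [y], with [p] the product of all other
    factors. *)
Lemma fnorm_smoothing m (g : 'I_m -> 'I_n) x y : x != y ->
  2 * fnorm g <= fnorm (fun z => if z == y then g x else g z) +
                 fnorm (fun z => if z == x then g y else g z).
Proof.
move=> xy; rewrite /fnorm.
pose p := \prod_(k | (k != x) && (k != y)) lform (V (g k)).
have E (h : 'I_m -> 'I_n) : (forall k, k != x -> k != y -> h k = g k) ->
    \prod_k lform (V (h k)) = lform (V (h x)) * (lform (V (h y)) * p).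
  move=> hg; rewrite (bigD1 x)//= (bigD1 y)/= 1?eq_sym//; congr (_ * (_ * _)).
  by apply: eq_bigr => k /andP[? ?]; rewrite hg.
rewrite !E//= ?eqxx.
- by rewrite (negPf xy) eq_sym (negPf xy); exact: fischer_smoothing.
- by move=> k /negPf ->.
- by move=> k _ /negPf ->.
Qed.

(** A hybrid sample: the first [k] letters are drawn without replacement, the letter at [K] is
    [s y], the others are free. For position k, the choice [y = K] prolongs the sample without
    replacement, while a uniform [y] gives an independent letter. *)
Let S k (K : 'I_n) (y : 'I_n) := \sum_(s : 'S_n) \sum_(g : {ffun 'I_n -> 'I_n})
  fnorm (fun x : 'I_n => if (x < k)%N then s x else if x == K then s y else g x).

Let S_le k (K y : 'I_n) : k = K :> nat -> S k K K <= S k K y.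
Proof.
move=> kK; have Kk : (K < k)%N = false by rewrite kK ltnn.
have tr : forall z, S k K z = \sum_(s : 'S_n) \sum_(g : {ffun 'I_n -> 'I_n})
    fnorm (fun x : 'I_n => if (x < k)%N then (tperm y K * s)%g x
      else if x == K then (tperm y K * s)%g z else g x).
  by move=> z; rewrite /S (reindex_inj (mulgI (tperm y K))).
(* If [y] is at least [k], then [s y] is a fresh letter just as [s K] is, and composing [s] with the
   transposition of [y] and [K] gives equality. *)
have [yk|ky] := ltnP y k; last first.
  rewrite [leRHS]tr le_eqVlt; apply/orP; left; apply/eqP.
  apply: eq_bigr => s _; apply: eq_bigr => g _; congr fnorm; apply/funext => x.
  rewrite !permM tpermL; case: ifPn => // xk.
  rewrite tpermD//; apply: contraTneq xk => <-.
    by rewrite -leqNgt.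
  by rewrite Kk.
have yK : y != K by apply: contraTneq yk => ->; rewrite Kk.
(* If [y] is below [k], then [s y] repeats the letter at [y]. Smoothing the positions [y] and [K]
   gives two words with a repeated letter, which the transposition exchanges. *)
suff : 2 * S k K K <= S k K y + S k K y by lra.
rewrite [X in _ <= _ + X]tr /S mulr_sumr -big_split/=; apply: ler_sum => s _.
rewrite mulr_sumr -big_split/=; apply: ler_sum => g _.
apply: le_trans (fnorm_smoothing _ yK) _.
rewrite le_eqVlt; apply/orP; left; apply/eqP; congr (_ + _).
  congr fnorm; apply/funext => x.
  by rewrite yk; case: eqP => [->|//]; rewrite Kk.
congr fnorm; apply/funext => x.
rewrite Kk eqxx !permM tpermL.
case: (eqVneq x y) => [->|xy]; first by rewrite yk tpermL.
case: ifPn => // xk; rewrite tpermD// 1?eq_sym//.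
by apply: contraTneq xk => ->; rewrite Kk.
Qed.

(** Interpolates between i.i.d. words at [k = 0] and words without repetition at [k = n]. *)
Let T k := \sum_(s : 'S_n) \sum_(g : {ffun 'I_n -> 'I_n})
  fnorm (fun x : 'I_n => if (x < k)%N then s x else g x).

(** Average of [S_le] over [y]: the choice [y = K] yields [T k.+1], and the mean over all [y] yields
    [T k]. *)
Let T_decr k : (k < n)%N -> T k.+1 <= T k.
Proof.
move=> kn; pose K := Ordinal kn.
have n0 : 0 < n%:R :> R by rewrite ltr0n (leq_trans _ kn).
rewrite -(ler_pM2l n0).
have -> : T k.+1 = S k K K.
  apply: eq_bigr => s _; apply: eq_bigr => g _; congr fnorm; apply/funext => x.
  rewrite ltnS leq_eqVlt.
  case: (eqVneq x K) => [->|xK] /=; first by rewrite eqxx/= ltnn.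
  suff /negPf -> : (x != k :> nat) by [].
  by apply: contraNneq xK => xk; apply/eqP/val_inj.
have -> : n%:R * T k = \sum_y S k K y.
  rewrite exchange_big /T mulr_sumr; apply: eq_bigr => s _.
  rewrite -[n in n%:R]card_ord -(sum_ffun_upd K) (reindex_inj (@perm_inj _ s)).
  apply: eq_bigr => y _; apply: eq_bigr => g _; congr fnorm; apply/funext => x.
  by rewrite ffunE.
rewrite -[n in n%:R]card_ord mulr_natl -sumr_const; apply: ler_sum => y _.
exact: S_le.
Qed.

(* Replacing a sample without replacement by an i.i.d. sample one coordinate at
   a time, fnorm increases on average by fnorm_smoothing. *)
Lemma fnorm_le_sum :
  n%:R ^+ n * fnorm (fun x : 'I_n => x) <= \sum_(g : {ffun 'I_n -> 'I_n}) fnorm g.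
Proof.
have T0 : T 0%N = n`!%:R * \sum_(g : {ffun 'I_n -> 'I_n}) fnorm g.
  by rewrite -(card_Sn n) mulr_natl -sumr_const.
(* At [k = n] the function [g] is not read, which gives the factor n^n, and the product does not
   depend on the order of its factors. *)
have Tn : T n = n`!%:R * (n%:R ^+ n * fnorm (fun x : 'I_n => x)).
  rewrite -(card_Sn n) mulr_natl -sumr_const; apply: eq_bigr => s _.
  have -> : n%:R ^+ n = #|{ffun 'I_n -> 'I_n}|%:R :> R.
    by rewrite card_ffun card_ord natrX.
  rewrite mulr_natl -sumr_const; apply: eq_bigr => g _.
  rewrite /fnorm; under eq_bigr do rewrite ltn_ord.
  by rewrite [in RHS](reindex_inj (@perm_inj _ s)).
have Tle : T n <= T 0%N.
  have: (n <= n)%N by [].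
  elim: {-2}n => // k IH kn; apply: le_trans (IH (ltnW kn)).
  exact: T_decr.
by move: Tle; rewrite T0 Tn ler_pM2l// ltr0n fact_gt0.
Qed.

End permanent_le_average.

(** * Positive semidefinite matrices: Cholesky factorization and trace inequalities *)

Section psd.
Variable R : rcfType.

Definition psd n (M : 'M[R]_n) : Prop :=
  M^T = M /\ forall x : 'cV[R]_n, 0 <= (x^T *m M *m x) 0 0.

Lemma quad_block n (M : 'M[R]_(1 + n)) (s : R) (y : 'cV[R]_n) :
  M^T = M ->
  ((col_mx s%:M y)^T *m M *m col_mx s%:M y) 0 0 =
  s ^+ 2 * M 0 0 + 2 * s * ((dlsubmx M)^T *m y) 0 0 +
  (y^T *m drsubmx M *m y) 0 0.
Proof.
move=> Msym; rewrite -{1}[M]submxK tr_col_mx mul_row_block mul_row_col.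
have -> : ursubmx M = (dlsubmx M)^T by rewrite trmx_dlsub Msym.
rewrite !mulmxDl tr_scalar_mx !mul_scalar_mx -!scalemxAl !mul_mx_scalar.
have -> : ulsubmx M = (M 0 0)%:M.
  apply/matrixP => i j; rewrite !mxE !ord1 eqxx mulr1n.
  by congr (M _ _); apply: val_inj.
have -> : y^T *m dlsubmx M = ((dlsubmx M)^T *m y).
  by apply: trmx_inj; rewrite trmx_mul trmxK [LHS]mx11_scalar
    [RHS]mx11_scalar !mxE.
rewrite !mxE eqxx mulr1n; ring.
Qed.

(** Induction on the Schur complement of the first entry [a]. If [a = 0], positivity forces the
    column [b] below it to vanish, and the convention [0^-1 = 0] keeps the same formulas valid. *)
Lemma psd_chol n (M : 'M[R]_n) : psd M -> exists U : 'M[R]_n, M = U *m U^T.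
Proof.
elim: n M => [|n IH] M [Msym Mge0].
  by exists 0; apply/matrixP => -[].
change 'M[R]_(1 + n) in (type of M).
pose b := dlsubmx M; pose a := M 0 0; pose C := drsubmx M.
have Mge s (y : 'cV[R]_n) : 0 <= s ^+ 2 * a + 2 * s * (b^T *m y) 0 0 +
                   (y^T *m C *m y) 0 0.
  by rewrite -quad_block//; exact: Mge0.
have a0 : 0 <= a.
  by have := Mge 1 0; rewrite !mulmx0 !mxE expr1n !mulr0 !addr0 mul1r.
have Mblock : M = block_mx a%:M b^T b C.
  rewrite -[LHS]submxK; congr block_mx.
    apply/matrixP => i j; rewrite !mxE !ord1 eqxx mulr1n.
    by congr (M _ _); apply: val_inj.
  by rewrite /b trmx_dlsub Msym.
have Csym : C^T = C by rewrite /C trmx_drsub Msym.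
have [U' CE] : exists U' : 'M[R]_n, C - a^-1 *: (b *m b^T) = U' *m U'^T.
  apply: IH; split.
    by rewrite linearB linearZ /= trmx_mul trmxK Csym.
  move=> y; set t := (b^T *m y) 0 0.
  have -> : (y^T *m (C - a^-1 *: (b *m b^T)) *m y) 0 0 =
            (y^T *m C *m y) 0 0 - a^-1 * t ^+ 2.
    rewrite mulmxBr mulmxBl -scalemxAr -scalemxAl [LHS]mxE [X in _ + X]mxE.
    congr (_ - _); rewrite mxE; congr (_ * _).
    transitivity (((b^T *m y)^T *m (b^T *m y)) 0 0).
      by rewrite trmx_mul trmxK !mulmxA.
    by rewrite mxE big_ord1 mxE -/t expr2.
  have [a_eq0|an0] := eqVneq a 0.
    rewrite a_eq0 invr0 mul0r subr0.
    by have := Mge 0 y; rewrite expr0n /= mul0r mulr0 mul0r !add0r.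
  (* The first coordinate is the minimizer of the quadratic form for fixed [y]. *)
  have := Mge (- (t / a)) y; rewrite -/t.
  have -> : (- (t / a)) ^+ 2 * a + 2 * - (t / a) * t = - (a^-1 * t ^+ 2).
    by field.
  by rewrite addrC.
have b0 : a = 0 -> b = 0.
  move=> aeq0; apply/colP => i; rewrite [RHS]mxE; apply/eqP; apply: contraT => bi0.
  pose e : 'cV[R]_n := delta_mx i 0.
  have E : (b^T *m e) 0 0 = b i 0.
    by rewrite -colE !mxE.
  set c := (e^T *m C *m e) 0 0.
  (* For [a = 0] the form is affine in the first coordinate; this choice would give it the value
     -1. *)
  have := Mge (- (c + 1) / (2 * b i 0)) e.
  rewrite aeq0 mulr0 add0r E -/c.
  have -> : 2 * (- (c + 1) / (2 * b i 0)) * b i 0 = - (c + 1) by field.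
  by lra.
pose W : 'M[R]_(1 + n) :=
  block_mx (Num.sqrt a)%:M 0 ((Num.sqrt a)^-1 *: b) U'.
suff WE : M = W *m W^T :> 'M[R]_(1 + n) by exists W.
rewrite /W tr_block_mx mulmx_block !trmx0 !mulmx0 !mul0mx !addr0 Mblock.
rewrite tr_scalar_mx -scalar_mxM -expr2 sqr_sqrtr// linearZ /=.
rewrite -scalemxAr mul_scalar_mx -scalemxAl mul_mx_scalar -scalemxAl.
rewrite -scalemxAr !scalerA -invfM -expr2 sqr_sqrtr// -CE addrC subrK.
have [/eqP aeq0|an0] := boolP (a == 0).
  by rewrite b0// !trmx0 !scaler0.
have sn0 : Num.sqrt a != 0 by rewrite sqrtr_eq0 -ltNge lt_def an0.
by rewrite mulVf// !scale1r.
Qed.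

Lemma tr_gram_ge0 n p (X : 'M[R]_(n, p)) : 0 <= \tr (X *m X^T).
Proof.
apply: sumr_ge0 => i _; rewrite !mxE; apply: sumr_ge0 => j _.
by rewrite mxE -expr2 sqr_ge0.
Qed.

Lemma psd_tr_conj n p (M : 'M[R]_n) (X : 'M[R]_(p, n)) :
  psd M -> 0 <= \tr (X *m M *m X^T).
Proof.
move=> /psd_chol[U ->]; have := tr_gram_ge0 (X *m U).
by rewrite trmx_mul !mulmxA.
Qed.

(** With B = U U^T, the power B^k is X^T X for X = B^j or X = U^T B^j, according to the parity of
    [k]. Cyclicity of the trace then reduces to [psd_tr_conj]. *)
Lemma psd_tr_exp n (B M : 'M[R]_n.+1) k :
  psd B -> psd M -> 0 <= \tr (B ^+ k * M).
Proof.
move=> pB pM; have Bsym j : (B ^+ j)^T = B ^+ j.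
  elim: j => [|j IH]; first by rewrite expr0 trmx1.
  by rewrite exprS trmx_mul IH pB.1 -[LHS]exprSr exprS.
rewrite -[k]odd_double_half; set j := k./2; case: (odd k) => /=.
  have [U BE] := psd_chol pB.
  have := psd_tr_conj (U^T *m B ^+ j) pM.
  rewrite trmx_mul trmxK Bsym -!mulmxA mxtrace_mulC -!mulmxA -BE.
  rewrite !mulmxA mxtrace_mulC !mulmxA mxtrace_mulC !mulmxA.
  suff -> : B ^+ j *m B *m B ^+ j = B ^+ (true + j.*2) by [].
  by rewrite -[X in X *m _]exprSr -[LHS]exprD addSn addnn.
have := psd_tr_conj (B ^+ j) pM.
rewrite Bsym mxtrace_mulC mulmxA -[X in X *m _]exprD addnn.
by rewrite add0n.
Qed.

Lemma psd1 n : psd (1%:M : 'M[R]_n).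
Proof.
split=> [|x]; first by rewrite trmx1.
rewrite mulmx1 mxE; apply: sumr_ge0 => i _.
by rewrite mxE -expr2 sqr_ge0.
Qed.

Lemma psd_tr_ge0 n (B : 'M[R]_n.+1) k : psd B -> 0 <= \tr (B ^+ k).
Proof. by move=> pB; rewrite -[B ^+ k]mulr1; apply: psd_tr_exp => //; exact: psd1. Qed.

(** Iteration of tr (B^(k+1) (c - B)) >= 0; it stands in for a bound [c] on the eigenvalues without
    diagonalizing. *)
Lemma psd_tr_exp_le n (B : 'M[R]_n.+1) (c : R) k :
  0 <= c -> psd B -> psd (c%:M - B) -> \tr (B ^+ k.+1) <= \tr B * c ^+ k.
Proof.
move=> c0 pB pcB; elim: k => [|k IH]; first by rewrite expr1 expr0 mulr1.
apply: le_trans (_ : c * \tr (B ^+ k.+1) <= _).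
  have := psd_tr_exp k.+1 pB pcB.
  by rewrite mulrBr -exprSr linearB /= subr_ge0 [_ * _]mul_mx_scalar mxtraceZ.
by rewrite [c ^+ k.+1]exprS mulrCA ler_wpM2l.
Qed.

(** With B = U U^T, the trace is the squared Frobenius norm of U, and Cauchy-Schwarz for each column
    of U bounds x^T B x, the squared length of U^T x. *)
Lemma psd_le_tr n (B : 'M[R]_n) : psd B -> psd ((\tr B)%:M - B).
Proof.
move=> pB; have [U BE] := psd_chol pB; split.
  by rewrite linearB /= tr_scalar_mx pB.1.
move=> x; rewrite mulmxBr mulmxBl [in X in 0 <= X]mxE mul_mx_scalar.
rewrite -scalemxAl mxE [X in _ + X]mxE subr_ge0 BE.
have -> : (x^T *m (U *m U^T) *m x) 0 0 = \sum_k (\sum_i x i 0 * U i k) ^+ 2.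
  rewrite mulmxA -mulmxA mxE; apply: eq_bigr => k _; rewrite expr2.
  congr (_ * _); rewrite mxE; apply: eq_bigr => i _; rewrite mxE//.
  by rewrite mulrC.
have -> : \tr (U *m U^T) = \sum_k \sum_i U i k ^+ 2.
  rewrite exchange_big; apply: eq_bigr => i _; rewrite mxE.
  by apply: eq_bigr => k _; rewrite mxE expr2.
rewrite mulr_suml; apply: ler_sum => k _.
have -> : (x^T *m x) 0 0 = \sum_i x i 0 ^+ 2.
  by rewrite mxE; apply: eq_bigr => i _; rewrite mxE expr2.
set a := \sum_i U i k ^+ 2; set b := \sum_i x i 0 ^+ 2.
set c := \sum_i _.
have a0 : 0 <= a by apply: sumr_ge0 => i _; exact: sqr_ge0.
have b0 : 0 <= b by apply: sumr_ge0 => i _; exact: sqr_ge0.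
have H s t : 0 <= s ^+ 2 * b + 2 * s * t * c + t ^+ 2 * a.
  have -> : s ^+ 2 * b + 2 * s * t * c + t ^+ 2 * a =
      \sum_i (s * x i 0 + t * U i k) ^+ 2.
    rewrite !mulr_sumr -!big_split/=; apply: eq_bigr => i _; ring.
  by apply: sumr_ge0 => i _; exact: sqr_ge0.
have [b_eq0|bn0] := eqVneq b 0.
  suff -> : c = 0 by rewrite expr0n /= mulr_ge0.
  rewrite /c big1// => i _; move/eqP: b_eq0.
  rewrite psumr_eq0; last by move=> ? _; exact: sqr_ge0.
  by move=> /allP /(_ i); rewrite mem_index_enum sqrf_eq0 => /(_ isT)/eqP ->;
    rewrite mul0r.
(* The discriminant argument for Cauchy-Schwarz, by evaluation at [s = - c], [t = b]. *)
have := H (- c) b; rewrite (_ : _ + _ = b * (a * b - c ^+ 2)); last by ring.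
by rewrite pmulr_rge0 ?lt_def ?bn0// subr_ge0.
Qed.

End psd.

(** * Newton's identities for the averaged Fischer norms *)

Section newton.
Variables (R : realFieldType) (n r : nat) (V : 'I_n.+1 -> 'I_r -> R).

Let A : 'M[R]_n.+1 := \matrix_(i, j) dotv (V i) (V j).
Let W m (g : 'I_m -> 'I_n.+1) := \prod_k lform (V (g k)).
Let Nsum m := \sum_(g : {ffun 'I_m -> 'I_n.+1}) fnorm V g.
(** A bilinear extension of [Nsum]: one factor differs on the two sides, with weights [M]. This
    family is stable under the adjunction, which multiplies [M] by the Gram matrix. *)
Let Nmix m (M : 'M[R]_n.+1) := \sum_i \sum_j M i j *
  \sum_(g : {ffun 'I_m -> 'I_n.+1})
    fischer (lform (V i) * W g) (lform (V j) * W g).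

Let Nmix1 m : Nmix m 1%:M = Nsum m.+1.
Proof.
transitivity (\sum_i \sum_(g : {ffun 'I_m -> 'I_n.+1})
    fischer (lform (V i) * W g) (lform (V i) * W g)).
  apply: eq_bigr => i _; rewrite (bigD1 i)//= mxE eqxx mul1r.
  rewrite [X in _ + X]big1 ?addr0// => j.
  by rewrite mxE eq_sym => /negPf ->; rewrite mul0r.
rewrite -(sum_ffun_lift ord0 (fun i (g : {ffun 'I_m -> 'I_n.+1}) =>
    fischer (lform (V i) * W g) (lform (V i) * W g))).
apply: eq_bigr => g _; rewrite /fnorm big_ord_recl.
suff -> : W [ffun x => g (lift ord0 x)] =
          \prod_(i < m) lform (V (g (lift ord0 i))) by [].
by apply: eq_bigr => k _; rewrite ffunE.
Qed.

Let trAM M : \tr (A *m M) = \sum_i \sum_j M i j * dotv (V i) (V j).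
Proof.
rewrite exchange_big; apply: eq_bigr => i _; rewrite mxE.
apply: eq_bigr => j _; rewrite mxE mulrC; congr (_ * _).
by apply: eq_bigr => k _; rewrite mulrC.
Qed.

(** After adjunction, the derivation along [V i] hits either the factor of [V j], which gives the
    trace term, or one of the [m.+1] letters of [g]. In the latter case the letter at that position
    [p] takes over the role of [i], and [M] becomes [A *m M]. *)
Let Nmix_rec m M :
  Nmix m.+1 M = \tr (A *m M) * Nsum m.+1 + m.+1%:R * Nmix m (A *m M).
Proof.
have E i j (g : {ffun 'I_m.+1 -> 'I_n.+1}) :
    fischer (lform (V i) * W g) (lform (V j) * W g) =
    dotv (V i) (V j) * fnorm V g +
    \sum_p dotv (V i) (V (g p)) *
      fischer (lform (V (g p)) * W [ffun x => g (lift p x)])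
              (lform (V j) * W [ffun x => g (lift p x)]).
  rewrite fischer_adj dderiv_lformM fischerDr fischerZr; congr (_ + _).
  rewrite dderiv_prod mulr_sumr fischer_sumr; apply: eq_bigr => p _.
  rewrite -scalerAr fischerZr; congr (_ * fischer _ (_ * _)).
    rewrite /W (bigD1_ord p)//=; congr (_ * _).
    by apply: eq_bigr => k _; rewrite ffunE.
  by apply: eq_bigr => k _; rewrite ffunE.
rewrite trAM mulr_suml mulr_sumr.
transitivity (\sum_i \sum_j (M i j * (dotv (V i) (V j) * Nsum m.+1) +
   M i j * (m.+1%:R * \sum_k dotv (V i) (V k) *
     \sum_(g : {ffun 'I_m -> 'I_n.+1})
       fischer (lform (V k) * W g) (lform (V j) * W g)))).
  apply: eq_bigr => i _; apply: eq_bigr => j _; rewrite -mulrDr; congr (_ * _).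
  under eq_bigr do rewrite E.
  rewrite big_split/= -mulr_sumr; congr (_ + _).
  have -> x : m.+1%:R * x = \sum_(p < m.+1) x.
    by rewrite sumr_const card_ord mulr_natl.
  rewrite exchange_big /=.
  apply: eq_bigr => p _.
  rewrite (sum_ffun_lift p (fun k (g : {ffun 'I_m -> 'I_n.+1}) =>
    dotv (V i) (V k) * fischer (lform (V k) * W g) (lform (V j) * W g))).
  by apply: eq_bigr => k _; rewrite mulr_sumr.
under eq_bigr do rewrite big_split/=.
rewrite big_split /=; congr (_ + _).
  by apply: eq_bigr => i _; rewrite mulr_suml; apply: eq_bigr => j _; rewrite mulrA.
rewrite (exchange_big_dep xpredT)//=.
under [RHS]eq_bigr do rewrite mulr_sumr.
rewrite [RHS](exchange_big_dep xpredT)//=; apply: eq_bigr => j _.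
transitivity (\sum_i \sum_k m.+1%:R * (A k i * M i j *
    \sum_(g : {ffun 'I_m -> 'I_n.+1})
       fischer (lform (V k) * W g) (lform (V j) * W g))).
  apply: eq_bigr => i _; rewrite mulrCA mulr_sumr mulr_sumr.
  apply: eq_bigr => k _; congr (_ * _); rewrite mulrA; congr (_ * _).
  rewrite mulrC mxE.
  congr (_ * _); apply: eq_bigr => x _; exact: mulrC.
rewrite (exchange_big_dep xpredT)//=; apply: eq_bigr => k _.
by rewrite -mulr_sumr -mulr_suml mxE.
Qed.

Let Nmix0 M : Nmix 0 M = \tr (A *m M) * Nsum 0.
Proof.
rewrite trAM mulr_suml; apply: eq_bigr => i _; rewrite mulr_suml.
apply: eq_bigr => j _; rewrite -mulrA; congr (_ * _); rewrite mulr_sumr.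
apply: eq_bigr => g _; rewrite fischer_adj dderiv_lformM.
by rewrite /fnorm /W !big_ord0 dderiv1 mulr0 addr0 fischerZr.
Qed.

Let NmixE m M : Nmix m M / m`!%:R =
  \sum_(k < m.+1) \tr (A ^+ k.+1 *m M) * (Nsum (m - k)%N / (m - k)`!%:R).
Proof.
elim: m M => [|m IH] M.
  by rewrite big_ord1 Nmix0 mulrA expr1.
rewrite big_ord_recl Nmix_rec mulrDl mulrA subn0 expr1; congr (_ + _).
rewrite factS natrM invfM mulrACA mulfV ?pnatr_eq0// mul1r IH.
apply: eq_bigr => k _; rewrite subSS; congr (\tr _ * _).
by rewrite lift0 [in RHS]exprSr -[RHS]mulmxA.
Qed.

(* Newton's identities: up to normalization, the moments are the complete
   homogeneous symmetric polynomials of the spectrum of A. *)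
Lemma fnorm_newton m (v := fun m => \sum_(g : {ffun 'I_m -> 'I_n.+1})
    fnorm V g / m`!%:R) :
  m.+1%:R * v m.+1 = \sum_(k < m.+1) \tr (A ^+ k.+1) * v (m - k)%N.
Proof.
have vE k : v k = Nsum k / k`!%:R by rewrite /v mulr_suml.
have m0 : m.+1%:R != 0 :> R by rewrite pnatr_eq0.
rewrite [in LHS]vE -Nmix1 factS natrM invfM mulrCA (mulVKf m0) NmixE.
by apply: eq_bigr => k _; rewrite mulmx1 vE.
Qed.

End newton.

(** * Negative binomial coefficients as a majorant *)

Section negative_binomial.
Variable R : realFieldType.
Implicit Types c r : R.

(* Coefficients of (1 - r t) ^ (- c / r), without division by r. *)
Definition nbin c r l : R := \prod_(i < l) ((c + i%:R * r) / i.+1%:R).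

(** Partial sums are the coefficients of (1 - t)^(-1) (1 - r t)^(- c / r); the first factor accounts
    for the eigenvalue 1. *)
Definition nbin_sum c r m : R := \sum_(l < m.+1) nbin c r l.

Lemma nbin0 c r : nbin c r 0 = 1. Proof. by rewrite /nbin big_ord0. Qed.

Lemma nbinS c r l : l.+1%:R * nbin c r l.+1 = (c + l%:R * r) * nbin c r l.
Proof.
by rewrite /nbin big_ord_recr/= mulrC -mulrA mulfVK ?pnatr_eq0// mulrC.
Qed.

Lemma nbin_ge0 c r l : 0 <= c -> 0 <= r -> 0 <= nbin c r l.
Proof.
by move=> c0 r0; apply: prodr_ge0 => i _; rewrite divr_ge0// addr_ge0// mulr_ge0.
Qed.

(** For [r = c] the generating function is the geometric series 1 / (1 - c t). *)
Lemma nbin_diag c l : nbin c c l = c ^+ l.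
Proof.
rewrite /nbin -[l in RHS]card_ord -prodr_const; apply: eq_bigr => i _.
by rewrite -{1}[c]mul1r -mulrDl addrC natr1 mulrAC mulfV ?mul1r ?pnatr_eq0.
Qed.

Lemma nbin_sumS c r m : nbin_sum c r m.+1 = nbin_sum c r m + nbin c r m.+1.
Proof. by rewrite /nbin_sum big_ord_recr. Qed.

(** The generating function F of the partial sums has logarithmic derivative 1 / (1 - t) + c / (1 -
    r t), whose coefficients 1 + c r^k act as power sums. *)
Lemma nbin_sum_newton c r m :
  m.+1%:R * nbin_sum c r m.+1 =
  \sum_(k < m.+1) (1 + c * r ^+ k) * nbin_sum c r (m - k)%N.
Proof.
(* With g = (1 - r t)^(- c / r), these are the coefficients of t g' / (1 - t). The relation g' = c g
   / (1 - r t) gives [EG], and the product rule for F = g / (1 - t) gives [DG]. *)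
pose G m := \sum_(j < m.+1) j%:R * nbin c r j.
have GS k : G k.+1 = \sum_(j < k.+1) (c + j%:R * r) * nbin c r j.
  rewrite /G big_ord_recl mul0r add0r; apply: eq_bigr => j _.
  by rewrite -nbinS.
have GSr k : G k.+1 = G k + k.+1%:R * nbin c r k.+1.
  by rewrite /G big_ord_recr.
have EG k : \sum_(j < k.+1) (c * r ^+ j) * nbin_sum c r (k - j)%N = G k.+1.
  elim: k => [|k IH].
    rewrite GS !big_ord1 expr0 mulr1 mul0r addr0; congr (_ * _).
    by rewrite /nbin_sum big_ord1.
  rewrite big_ord_recl expr0 mulr1 subn0.
  have -> : \sum_(i < k.+1) c * r ^+ lift ord0 i *
              nbin_sum c r (k.+1 - lift ord0 i) = r * G k.+1.
    rewrite -IH mulr_sumr; apply: eq_bigr => i _.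
    by rewrite lift0 subSS exprS mulrCA !mulrA.
  rewrite [RHS]GS /nbin_sum /G !mulr_sumr -big_split/=.
  by apply: eq_bigr => i _; ring.
have DG k : \sum_(j < k.+1) nbin_sum c r (k - j)%N + G k.+1 =
            k.+1%:R * nbin_sum c r k.+1.
  elim: k => [|k IH].
    rewrite big_ord1 /G /nbin_sum !big_ord_recr !big_ord0 /=; ring.
  rewrite big_ord_recl subn0.
  have -> : \sum_(i < k.+1) nbin_sum c r (k.+1 - lift ord0 i) =
            \sum_(j < k.+1) nbin_sum c r (k - j) by [].
  rewrite GSr addrA -(addrA (nbin_sum _ _ _)) IH.
  by rewrite [in RHS]nbin_sumS -[k.+2%:R]natr1; ring.
rewrite -DG -EG -big_split/=; apply: eq_bigr => k _; ring.
Qed.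

(** Newton's recursion has nonnegative coefficients, so it is monotone in the power sums and in the
    initial value. *)
Lemma newton_le_nbin_sum c r (q v : nat -> R) :
  0 <= c -> 0 <= r -> v 0%N <= 1 -> (forall k, 0 <= q k <= 1 + c * r ^+ k) ->
  (forall m, m.+1%:R * v m.+1 = \sum_(k < m.+1) q k * v (m - k)%N) ->
  forall m, v m <= nbin_sum c r m.
Proof.
move=> c0 r0 v0 qle vE m.
elim: m {-2}m (leqnn m) => [|m IH] j.
  by rewrite leqn0 => /eqP ->; rewrite /nbin_sum big_ord1 nbin0.
case: j => [_|j jm]; first by rewrite /nbin_sum big_ord1 nbin0.
have j0 : 0 < j.+1%:R :> R by rewrite ltr0n.
rewrite -(ler_pM2l j0) vE nbin_sum_newton; apply: ler_sum => k _.
have /andP[q0 q1] := qle k.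
apply: le_trans (_ : q k * nbin_sum c r (j - k) <= _).
  by rewrite ler_wpM2l// IH// (leq_trans (leq_subr _ _)).
rewrite ler_wpM2r//; apply: sumr_ge0 => i _; exact: nbin_ge0.
Qed.

End negative_binomial.

(** * Bounds on the permanent in terms of the trace and a spectral bound *)

Section permanent_bound.
Variables (R : rcfType) (n : nat) (B : 'M[R]_n.+1).
Hypotheses (psdB : psd B) (B0 : forall i, \sum_j B i j = 0).

(** The constant matrix [J] is a projection of trace 1 with J B = B J = 0, so tr (J + B)^k = 1 + tr
    B^k for k >= 1. The permanent of the Gram matrix J + B is at most the i.i.d. average, whose
    Newton recursion is compared with that of [nbin_sum]. *)
Lemma permanent_le_nbin_sum (r : R) : 0 <= r -> psd (r%:M - B) ->
  n.+1%:R ^+ n.+1 / n.+1`!%:R *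
    permanent (fun i j => n.+1%:R^-1 + B i j) <= nbin_sum (\tr B) r n.+1.
Proof.
move=> r0 prB.
pose J : 'M[R]_n.+1 := const_mx n.+1%:R^-1.
have n0 : n.+1%:R != 0 :> R by rewrite pnatr_eq0.
have BJ : B * J = 0.
  apply/matrixP => i j; rewrite !mxE.
  transitivity ((\sum_k B i k) * n.+1%:R^-1); last by rewrite B0 mul0r.
  rewrite mulr_suml; by apply: eq_bigr => k _; rewrite mxE.
have Jsym : J^T = J by apply/matrixP => i j; rewrite !mxE.
have JB : J * B = 0.
  by apply: trmx_inj; rewrite [LHS]trmx_mul psdB.1 Jsym [LHS]BJ trmx0.
have JJ : J * J = J.
  apply/matrixP => i j; rewrite !mxE (eq_bigr (fun=> n.+1%:R^-1 * n.+1%:R^-1)).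
    by rewrite sumr_const card_ord -[LHS]mulr_natl mulrA mulfV// mul1r.
  by move=> k _; rewrite !mxE.
have trJ : \tr J = 1.
  rewrite /mxtrace (eq_bigr (fun=> n.+1%:R^-1)) => [|i _]; last by rewrite mxE.
  by rewrite sumr_const card_ord -[LHS]mulr_natl mulfV.
have psdJ : psd J.
  split=> // x; rewrite mxE.
  have -> : \sum_j (x^T *m J) 0 j * x j 0 = n.+1%:R^-1 * (\sum_i x i 0) ^+ 2.
    rewrite expr2 mulrA mulr_sumr; apply: eq_bigr => j _; congr (_ * _).
    by rewrite mxE mulr_sumr; apply: eq_bigr => i _; rewrite !mxE mulrC.
  by rewrite mulr_ge0 ?sqr_ge0.
have psdA : psd (J + B).
  split=> [|x]; first by rewrite linearD /= Jsym psdB.1.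
  by rewrite mulmxDr mulmxDl mxE addr_ge0// ?psdJ.2 ?psdB.2.
(* The rows of [U] are vectors whose Gram matrix is J + B. *)
have [U AE] := psd_chol psdA.
pose V i k := U i k.
have AV : J + B = \matrix_(i, j) dotv (V i) (V j).
  by rewrite AE; apply/matrixP => i j; rewrite !mxE; apply: eq_bigr => k _; rewrite mxE.
have Aexp k : (J + B) ^+ k.+1 = J + B ^+ k.+1.
  elim: k => [|k IH]; first by rewrite !expr1.
  rewrite exprS IH mulrDl !mulrDr JJ -!exprS.
  have -> : J * B ^+ k.+1 = 0 by rewrite exprS mulrA JB mul0r.
  by rewrite BJ add0r addr0.
pose v m := \sum_(g : {ffun 'I_m -> 'I_n.+1}) fnorm V g / m`!%:R.
have vnewton m : m.+1%:R * v m.+1 =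
    \sum_(k < m.+1) \tr ((J + B) ^+ k.+1) * v (m - k)%N.
  by rewrite AV; exact: fnorm_newton.
have vle : v n.+1 <= nbin_sum (\tr B) r n.+1.
  apply: (newton_le_nbin_sum (q := fun k => \tr ((J + B) ^+ k.+1)) _ r0 _ _ vnewton).
  - exact: (psd_tr_ge0 1 psdB).
  - rewrite /v (bigD1 [ffun x => ord0])//= big1 => [|g].
      by rewrite /fnorm !big_ord0 fischer1 mul1r invr1 addr0.
    by move=> /eqP[]; apply/ffunP => -[].
  - move=> k; rewrite (psd_tr_ge0 k.+1 psdA)/= Aexp linearD /= trJ lerD2l.
    exact: psd_tr_exp_le.
apply: le_trans vle; rewrite /v -mulr_suml mulrAC ler_wpM2r ?invr_ge0//.
suff -> : permanent (fun i j => n.+1%:R^-1 + B i j) = fnorm V id.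
  exact: fnorm_le_sum.
rewrite /fnorm fischer_prod; apply: eq_bigr => s _; apply: eq_bigr => i _.
by have /matrixP/(_ i (s i)) := AV; rewrite !mxE.
Qed.

End permanent_bound.

(** The generating polynomial [p] of the coefficients, divided by exp (a t - b ln (1 - r t)), is
    nonincreasing on [0, 1] and equals 1 at 0; its value at 1 gives the bound. The derivative has
    the right sign since c <= a (1 - r) + b r <= a (1 - r t) + b r. *)
Lemma nbin_sum_le_expR (R : realType) (c r a b : R) n :
  0 <= c -> 0 <= r < 1 -> 0 <= a -> c <= a * (1 - r) + b * r ->
  nbin_sum c r n <= expR (a - b * ln (1 - r)).
Proof.
move=> c0 /andP[r0 r1] a0 cab.
pose p : {poly R} := \poly_(l < n.+1) nbin c r l.
pose q : {poly R} := 1 - r%:P * 'X.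
have qE t : q.[t] = 1 - r * t by rewrite /q !hornerE.
pose h : R -> R := horner (- (a%:P * 'X)) + (b *: (@ln R \o horner q) : R -> R).
have hE t : h t = - (a * t - b * ln (1 - r * t)).
  rewrite (_ : h t = (- (a%:P * 'X)).[t] + b * ln q.[t])// qE !hornerE; ring.
pose f : R -> R := horner p * (@expR R \o h).
have fE t : f t = p.[t] * expR (h t) by [].
have p1 : p.[1] = nbin_sum c r n.
  rewrite horner_poly; apply: eq_bigr => l _; by rewrite expr1n mulr1.
have p0 : p.[0] = 1.
  by rewrite horner_coef0 coef_poly /= nbin0.
have rt (t : R) : 0 <= t <= 1 -> 0 < 1 - r * t.
  move=> /andP[t0 t1]; rewrite subr_gt0 (le_lt_trans _ r1)//.
  by rewrite -[leRHS]mulr1 ler_wpM2l.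
pose h' t : R := - (a + b * r / (1 - r * t)).
have dh (t : R) : 0 <= t <= 1 -> is_derive t (1 : R) h (h' t).
  move=> /rt t01.
  have dq : is_derive q.[t] (1 : R) (@ln R) q.[t]^-1.
    by apply: is_derive1_ln; rewrite qE.
  have dln := is_derive1_comp dq (is_derive_poly q t).
  have q'E : q^`().[t] = - r.
    by rewrite /q derivB derivC derivM derivC derivX !hornerE.
  have a'E : (- (a%:P * 'X))^`().[t] = - a.
    by rewrite derivN derivM derivC derivX !hornerE.
  have := is_deriveD (is_derive_poly (- (a%:P * 'X)) t) (is_deriveZ b dln).
  rewrite a'E q'E qE (_ : _ + _ = h' t)//.
  by rewrite /h' (_ : b *: _ = b * ((1 - r * t)^-1 * - r))//; ring.
have df (t : R) : 0 <= t <= 1 ->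
    is_derive t (1 : R) f (expR (h t) * (p^`().[t] + p.[t] * h' t)).
  move=> t01; have d := dh t t01.
  have de := is_derive1_comp (is_derive_expR (h t)) d.
  have := is_deriveM (is_derive_poly p t) de.
  rewrite (_ : _ + _ = expR (h t) * (p^`().[t] + p.[t] * h' t))//.
  by rewrite -![_ *: _]/(_ * _) /=; ring.
(* The full series satisfies (1 - r t) p' = c p; truncation only affects the term of degree [n], and
   with a favourable sign. *)
have pd (t : R) : 0 <= t <= 1 -> p^`().[t] * (1 - r * t) <= c * p.[t].
  move=> /andP[t0 _].
  have sp : (size p^`() <= n)%N.
    by rewrite (leq_trans (size_poly _ _))// -subn1 leq_subLR add1n size_poly.
  have p'E : p^`().[t] = \sum_(l < n) l.+1%:R * nbin c r l.+1 * t ^+ l.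
    rewrite (horner_coef_wide t sp); apply: eq_bigr => l _.
    by rewrite coef_deriv coef_poly ltnS ltn_ord mulr_natl.
  have tp'E : t * p^`().[t] = \sum_(l < n.+1) l%:R * nbin c r l * t ^+ l.
    rewrite big_ord_recl mul0r mul0r add0r p'E mulr_sumr.
    by apply: eq_bigr => l _; rewrite exprS mulrCA.
  have -> : p^`().[t] * (1 - r * t) =
            \sum_(l < n) c * (nbin c r l * t ^+ l) - r * n%:R * nbin c r n * t ^+ n.
    have -> : p^`().[t] * (1 - r * t) = p^`().[t] - r * (t * p^`().[t]).
      by ring.
    rewrite tp'E p'E.
    rewrite big_ord_recr /= mulrDr opprD addrA !mulrA; congr (_ - _).
    rewrite mulr_sumr -sumrB; apply: eq_bigr => l _; rewrite nbinS; ring.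
  rewrite horner_poly mulr_sumr [leRHS]big_ord_recr /= lerD2l.
  apply: le_trans (_ : 0 <= _); last by rewrite !mulr_ge0 ?nbin_ge0 ?exprn_ge0.
  by rewrite oppr_le0 !mulr_ge0 ?nbin_ge0 ?exprn_ge0.
have fle : f 1 <= f 0.
  apply: (@ler0_derive1_nincr _ f 0 1) => //.
  - move=> t; rewrite in_itv/= => /andP[t0 t1].
    by have [] := df t (introT andP (conj (ltW t0) (ltW t1))).
  - move=> t; rewrite in_itv/= => /andP[t0 t1].
    have t01 : 0 <= t <= 1 by rewrite !ltW.
    rewrite derive1E (@derive_val _ _ _ _ _ _ _ (df t t01)).
    rewrite pmulr_rle0 ?expR_gt0// /h' mulrN subr_le0.
    have rt0 := rt t t01; rewrite -(ler_pM2r rt0).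
    apply: le_trans (pd t t01) _.
    have pt0 : 0 <= p.[t].
      rewrite horner_poly; apply: sumr_ge0 => l _.
      by rewrite mulr_ge0 ?nbin_ge0 ?exprn_ge0// ltW.
    rewrite [c * _]mulrC -[leRHS]mulrA ler_wpM2l//.
    rewrite mulrDl mulfVK ?gt_eqF//.
    apply: le_trans cab _; rewrite lerD2r ler_wpM2l// lerD2l lerN2.
    by rewrite ler_piMr// ltW.
  - apply: derivable_within_continuous => t; rewrite in_itv/= => t01.
    by have [] := df t t01.
move: fle; rewrite !fE p1 p0 mul1r !hE !mulr0 subr0 ln1 mulr0 subr0 oppr0 expR0 !mulr1.
by rewrite expRN ler_pdivrMr ?expR_gt0// mul1r.
Qed.

(** * Dependence of the permanent on the scale of B, and the bounds in matrix form *)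

Section permanent_expansion.
Variables (R : rcfType) (n : nat).
Local Notation N := (n.+1).

(** By multilinearity this is per(1 + N B) / N!. *)
Definition perm_ratio (B : 'M[R]_N) : R :=
  N%:R ^+ N / N`!%:R * permanent (fun i j => N%:R^-1 + B i j).

(** The double sum over permutations is redundant by a factor N!, but its symmetry makes the
    coefficient a sum of squares. *)
Let coef (B : 'M[R]_N) (J : {set 'I_N}) : R :=
  \sum_(s : 'S_N) \sum_(t : 'S_N) \prod_(i in J) B (s i) (t i).

(** The factor N! turns the permanent into a sum over two permutations; [J] is then the set of
    indices where the product of binomials contributes its [B] term. *)
Let perm_ratioE (s : R) (B : 'M[R]_N) : perm_ratio (s *: B) =
  \sum_(J : {set 'I_N}) (N%:R * s) ^+ #|J| * coef B J / N`!%:R ^+ 2.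
Proof.
have f0 : N`!%:R != 0 :> R by rewrite pnatr_eq0 -lt0n fact_gt0.
have n0 : N%:R != 0 :> R by rewrite pnatr_eq0.
apply: (mulIf (expf_neq0 2 f0)); rewrite mulr_suml.
under [RHS]eq_bigr do rewrite mulfVK ?expf_neq0//.
rewrite /perm_ratio.
have -> (x y : R) : x / N`!%:R * y * N`!%:R ^+ 2 = x * (y * N`!%:R) by field.
have -> : permanent (fun i j => N%:R^-1 + (s *: B) i j) * N`!%:R =
  \sum_(t : 'S_N) \sum_(u : 'S_N) \prod_i (N%:R^-1 + s * B (t i) (u i)).
  rewrite mulrC -(card_Sn N) mulr_natl -sumr_const; apply: eq_bigr => t _.
  rewrite /permanent (reindex_inj (mulgI t^-1)%g) /=.
  apply: eq_bigr => u _; rewrite (reindex_inj (@perm_inj _ t)) /=.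
  by apply: eq_bigr => i _; rewrite permM permK !mxE.
have -> : \sum_(J : {set 'I_N}) (N%:R * s) ^+ #|J| * coef B J =
    \sum_(t : 'S_N) \sum_(u : 'S_N) \sum_(J : {set 'I_N})
      (N%:R * s) ^+ #|J| * \prod_(i in J) B (t i) (u i).
  under [RHS]eq_bigr do rewrite exchange_big.
  rewrite [RHS]exchange_big /=; apply: eq_bigr => J _.
  by rewrite /coef mulr_sumr; apply: eq_bigr => t _; rewrite mulr_sumr.
rewrite mulr_sumr; apply: eq_bigr => t _; rewrite mulr_sumr; apply: eq_bigr => u _.
rewrite -[N in _ ^+ N]card_ord -prodr_const -big_split /=.
under eq_bigr do rewrite mulrDr mulfV// mulrA addrC.
rewrite bigA_distr; apply: eq_bigr => J _.
by rewrite -big_mkcond big_split /= prodr_const.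
Qed.

Let sum_perm_app (F : 'I_N -> R) i : \sum_j F j = 0 -> \sum_(t : 'S_N) F (t i) = 0.
Proof.
move=> F0; have n0 : N%:R != 0 :> R by rewrite pnatr_eq0.
apply/eqP; rewrite -(mulrI_eq0 _ (mulfI n0)); apply/eqP.
rewrite -[N in N%:R]card_ord mulr_natl -sumr_const.
rewrite (eq_bigr (fun j => \sum_(t : 'S_N) F (t j))) => [|j _].
  rewrite exchange_big big1// => t _.
  by rewrite -[RHS]F0 [RHS](reindex_inj (@perm_inj _ t)).
rewrite (reindex_inj (mulgI (tperm i j))) /=.
by apply: eq_bigr => t _; rewrite permM tpermL.
Qed.

(** With B = U U^T and the product over [J] expanded along maps f from [J] to the columns of U, the
    sums over the two permutations separate into a square. *)
Let coef_ge0 B J : psd B -> 0 <= coef B J.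
Proof.
move=> /psd_chol[U ->].
have -> : coef (U *m U^T) J =
    \sum_(f in pffun_on ord0 (mem J) predT)
      (\sum_(s : 'S_N) \prod_(i in J) U (s i) (f i)) ^+ 2.
  rewrite /coef; under eq_bigr => s _.
    under eq_bigr => t _.
      under eq_bigr do rewrite mxE.
      rewrite (big_distr_big ord0) /=.
      over.
    rewrite exchange_big /=; over.
  rewrite exchange_big /=; apply: eq_bigr => f _.
  rewrite expr2 mulr_suml; apply: eq_bigr => s _.
  rewrite mulr_sumr; apply: eq_bigr => t _.
  by rewrite -big_split; apply: eq_bigr => i _; rewrite mxE.
by apply: sumr_ge0 => f _; exact: sqr_ge0.
Qed.

Variable B : 'M[R]_N.
Hypotheses (psdB : psd B) (B0 : forall i, \sum_j B i j = 0).

(* perm_ratio (s *: B) is a polynomial in s with nonnegative coefficients,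
   constant coefficient 1 and no linear term. *)
Lemma perm_ratio_scale s : 1 <= s ->
  s ^+ 2 * (perm_ratio B - 1) <= perm_ratio (s *: B) - 1.
Proof.
move=> s1.
have f0 : N`!%:R != 0 :> R by rewrite pnatr_eq0 -lt0n fact_gt0.
have E u : perm_ratio (u *: B) - 1 = \sum_(J : {set 'I_N} | (1 < #|J|)%N)
    (N%:R * u) ^+ #|J| * coef B J / N`!%:R ^+ 2.
  rewrite perm_ratioE (bigD1 (finset.set0 : {set 'I_N}))//= cards0 expr0 mul1r.
  have -> : coef B finset.set0 = N`!%:R ^+ 2.
    rewrite /coef (eq_bigr (fun=> N`!%:R)) => [|t _].
      by rewrite sumr_const card_Sn -[LHS]mulr_natl -expr2.
    rewrite (eq_bigr (fun=> 1)) => [|u' _]; last by rewrite big_set0.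
    by rewrite sumr_const card_Sn.
  rewrite mulfV ?expf_neq0// addrAC subrr add0r.
  rewrite (bigID (fun J : {set 'I_N} => (1 < #|J|)%N))/=.
  (* One-element sets give the linear term, which vanishes because a random permutation sends an
     index to a uniform one and the rows of [B] sum to zero. *)
  rewrite [X in _ + X]big1 => [|J /andP[J0]]; last first.
    rewrite -leqNgt => J1.
    have /cards1P[i ->{J J0 J1}] : #|J| == 1%N by rewrite eqn_leq J1 card_gt0.
    suff -> : coef B (finset.set1 i) = 0 by rewrite mulr0 mul0r.
    rewrite /coef big1// => t _.
    under eq_bigr do rewrite big_set1.
    exact: sum_perm_app.
  rewrite addr0; apply: eq_bigl => J; apply: andb_idl => J1.
  by rewrite -card_gt0 (ltn_trans _ J1).
rewrite E -[B in perm_ratio B]scale1r E mulr_sumr; apply: ler_sum => J J1.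
rewrite !mulrA ler_wpM2r ?invr_ge0 ?exprn_ge0// ler_wpM2r ?coef_ge0//.
rewrite mulr1 exprMn mulrC ler_wpM2l ?exprn_ge0//.
by rewrite ler_weXn2l.
Qed.

(** By [psd_le_tr] the trace itself is an admissible spectral bound, and then the coefficients are
    geometric. *)
Lemma perm_ratio_le_sum : perm_ratio B <= \sum_(l < N.+1) (\tr B) ^+ l.
Proof.
have trB0 : 0 <= \tr B by exact: (psd_tr_ge0 1 psdB).
apply: le_trans (permanent_le_nbin_sum psdB B0 trB0 (psd_le_tr psdB)) _.
rewrite /nbin_sum le_eqVlt; apply/orP; left; apply/eqP.
by apply: eq_bigr => l _; rewrite nbin_diag.
Qed.

End permanent_expansion.

(** [perm_ratio_le_sum] has the extra linear term c = tr B. For c > 1/2 the quadratic term absorbs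
    it; for smaller c the matrix is scaled up to trace 1/2 and [perm_ratio_scale] carries the bound
    back. *)
Lemma perm_ratio_le (R : rcfType) n (B : 'M[R]_n.+1) :
  psd B -> (forall i, \sum_j B i j = 0) ->
  perm_ratio B <= 1 + 10 * \sum_(2 <= l < n.+2) (\tr B) ^+ l.
Proof.
move=> psdB B0; set c := \tr B.
have c0 : 0 <= c by exact: (psd_tr_ge0 1 psdB).
have sum0 m : 0 <= \sum_(2 <= l < m) c ^+ l.
  by apply: sumr_ge0 => l _; rewrite exprn_ge0.
have sumE : \sum_(l < n.+2) c ^+ l = 1 + c + \sum_(2 <= l < n.+2) c ^+ l.
  rewrite -(big_mkord xpredT (fun l => c ^+ l)) big_ltn// big_ltn// addrA.
  by rewrite expr0 expr1.
have := perm_ratio_le_sum psdB B0; rewrite -/c sumE => le1.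
have [c_eq0|cn0] := eqVneq c 0.
  apply: le_trans le1 _; rewrite c_eq0 addr0 lerD2l.
  rewrite big_nat_cond big1 ?mulr0// => l /andP[/andP[l2 _] _].
  by rewrite expr0n; case: l l2.
have cp : 0 < c by rewrite lt_def cn0.
(* Zero row sums make a one by one matrix vanish; hence the sum on the right contains its term l =
   2. *)
have n1 : (0 < n)%N.
  rewrite lt0n; apply: contraNneq cn0 => n0; rewrite /c /mxtrace big1// => i _.
  rewrite -[RHS](B0 i) (bigD1 i)//= big1 ?addr0// => j /eqP[].
  have k0 (k : 'I_n.+1) : k = 0 :> nat.
    by apply/eqP; rewrite -leqn0 -n0 -ltnS.
  by apply: val_inj; rewrite /= !k0.
have c2 : c ^+ 2 <= \sum_(2 <= l < n.+2) c ^+ l.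
  by rewrite big_ltn// lerDl; apply: sumr_ge0 => l _; rewrite exprn_ge0.
(* If c > 1/2, then c < 2 c^2, so even the constant 3 would do. *)
have [cle|cgt] := lerP c (1 / 2); last by nra.
(* At trace 1/2 the geometric sum is at most 2; scaling back by s^(-2) = 4 c^2 gives perm_ratio B -
   1 <= 4 c^2. *)
pose s := (2 * c)^-1.
have s1 : 1 <= s by rewrite invf_ge1 ?mulr_gt0//; lra.
have sp : 0 <= s by rewrite (le_trans _ s1).
have psB : psd (s *: B).
  split=> [|x]; first by rewrite linearZ /= psdB.1.
  by rewrite -scalemxAr -scalemxAl mxE mulr_ge0// psdB.2.
have sB0 i : \sum_j (s *: B) i j = 0.
  by under eq_bigr do rewrite mxE; rewrite -mulr_sumr B0 mulr0.
have fs : perm_ratio (s *: B) <= 2.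
  apply: le_trans (perm_ratio_le_sum psB sB0) _.
  rewrite mxtraceZ -/c (_ : s * c = 2^-1); last by rewrite /s; field.
  have E m : \sum_(l < m) (2^-1 : R) ^+ l = 2 - 2 * 2^-1 ^+ m.
    elim: m => [|m IH]; first by rewrite big_ord0 expr0; ring.
    by rewrite big_ord_recr/= IH exprS; field.
  by rewrite E gerBl mulr_ge0// exprn_ge0// invr_ge0.
have := perm_ratio_scale psdB B0 s1.
set f := perm_ratio B in le1 *; set g := perm_ratio _ in fs * => fg.
have : f - 1 <= 4 * c ^+ 2.
  have : s ^+ 2 * (f - 1) <= 1 by lra.
  have -> : s ^+ 2 = (4 * c ^+ 2)^-1 by rewrite /s; field.
  by rewrite mulrC ler_pdivrMr ?mul1r// mulr_gt0// exprn_gt0.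
have := sum0 n.+2; lra.
Qed.

(** Doeblin minorization: a lower bound [d] on the entries of 1 + N B bounds the quadratic form of
    [B] by 1 - d, so that [permanent_le_nbin_sum] and [nbin_sum_le_expR] apply with r = 1 - d. *)
Lemma perm_ratio_le_expR (R : realType) n (B : 'M[R]_n.+1) (d a b : R) :
  psd B -> (forall i, \sum_j B i j = 0) -> 0 < d <= 1 ->
  (forall i j, d <= 1 + n.+1%:R * B i j) ->
  0 <= a -> \tr B <= a * d + b * (1 - d) ->
  perm_ratio B <= expR (a - b * ln d).
Proof.
move=> psdB B0 /andP[d0 d1] dB a0 cab.
have N0 : 0 < n.+1%:R :> R by rewrite ltr0n.
have r0 : 0 <= 1 - d by rewrite subr_ge0.
have psdr : psd ((1 - d)%:M - B).
  split=> [|x]; first by rewrite linearB /= tr_scalar_mx psdB.1.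
  have Bsym i j : B i j = B j i by rewrite -{1}psdB.1 mxE.
  (* This matrix has nonnegative entries and row sums 1 - d. Its Laplacian form, the sum of D_ij
     (x_i - x_j)^2, is nonnegative, hence x^T D x <= (1 - d) |x|^2; the constant part of [D] only
     adds a square. *)
  pose D i j := (1 - d) / n.+1%:R + B i j.
  have D0 i j : 0 <= D i j.
    rewrite /D -(pmulr_rge0 _ N0) mulrDr mulrCA mulfV ?gt_eqF// mulr1.
    by have := dB i j; lra.
  have sumx : \sum_i x i 0 ^+ 2 * (1 - d) = \sum_i \sum_j D i j * x i 0 ^+ 2.
    apply: eq_bigr => i _; rewrite -mulr_suml mulrC; congr (_ * _).
    rewrite /D big_split/= B0 addr0 sumr_const card_ord -[RHS]mulr_natl.
    by rewrite mulrCA mulfV ?gt_eqF// mulr1.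
  have sumx' : \sum_i x i 0 ^+ 2 * (1 - d) = \sum_i \sum_j D i j * x j 0 ^+ 2.
    rewrite sumx exchange_big; apply: eq_bigr => i _; apply: eq_bigr => j _.
    by rewrite /D Bsym.
  have quadB : (x^T *m B *m x) 0 0 = \sum_i \sum_j B i j * (x i 0 * x j 0).
    rewrite mxE exchange_big; apply: eq_bigr => j _; rewrite mxE mulr_suml.
    by apply: eq_bigr => i _; rewrite mxE; ring.
  have quadD : \sum_i \sum_j D i j * (x i 0 * x j 0) =
      (1 - d) / n.+1%:R * (\sum_i x i 0) ^+ 2 + (x^T *m B *m x) 0 0.
    rewrite quadB expr2 mulr_suml mulr_sumr -big_split; apply: eq_bigr => i _ /=.
    rewrite mulr_sumr mulr_sumr -big_split; apply: eq_bigr => j _ /=.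
    by rewrite /D; ring.
  rewrite mulmxBr mulmxBl mxE [X in _ + X]mxE.
  rewrite subr_ge0 mul_mx_scalar -scalemxAl [leRHS]mxE.
  have -> : (x^T *m x) 0 0 = \sum_i x i 0 ^+ 2.
    by rewrite mxE; apply: eq_bigr => i _; rewrite mxE expr2.
  rewrite mulrC mulr_suml.
  have J0 : 0 <= (1 - d) / n.+1%:R * (\sum_i x i 0) ^+ 2.
    by rewrite mulr_ge0 ?sqr_ge0// divr_ge0.
  have : 0 <= \sum_i \sum_j D i j * (x i 0 - x j 0) ^+ 2.
    by do 2!apply: sumr_ge0 => ? _; rewrite mulr_ge0 ?sqr_ge0.
  have -> : \sum_i \sum_j D i j * (x i 0 - x j 0) ^+ 2 =
    \sum_i \sum_j D i j * x i 0 ^+ 2 + \sum_i \sum_j D i j * x j 0 ^+ 2 -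
    2 * \sum_i \sum_j D i j * (x i 0 * x j 0).
    rewrite mulr_sumr -!big_split/= -sumrB; apply: eq_bigr => i _.
    rewrite mulr_sumr -!big_split/= -sumrB; apply: eq_bigr => j _; ring.
  rewrite -sumx -sumx' quadD; move: J0.
  have key (X Y Z : R) : 0 <= Z -> 0 <= X + X - 2 * (Z + Y) -> Y <= X by lra.
  exact: key.
apply: le_trans (permanent_le_nbin_sum psdB B0 r0 psdr) _.
rewrite -[d in ln d](subKr 1 d).
apply: nbin_sum_le_expR => //; first exact: (psd_tr_ge0 1 psdB).
- by rewrite r0/= gtrBl.
- by rewrite subKr.
Qed.

Local Open Scope classical_set_scope.
Local Open Scope ring_scope.
Local Open Scope ereal_scope.
Local Open Scope charge_scope.

(** * Densities and the variational form of the chi^2 divergence *)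

Section density.
Context d (T : measurableType d) (R : realType).
Implicit Types (P Q : probability T R) (f : T -> R) (g : T -> \bar R).

(** A finite, everywhere nonnegative version of the Radon-Nikodym derivative, which permits
    pointwise real arithmetic. *)
Definition is_density f P Q :=
  [/\ measurable_fun [set: T] f, (forall x, (0 <= f x)%R) &
      forall A, measurable A -> P A = \int[Q]_(x in A) (f x)%:E].

Lemma density_dominates f P Q : is_density f P Q -> P `<< Q.
Proof.
move=> [mf f0 PE]; apply/null_content_dominatesP => A mA QA0.
rewrite PE// null_set_integral//.
by apply: measurable_funTS; exact/measurable_EFinP.
Qed.

Lemma exists_density P Q : P `<< Q -> exists f, is_density f P Q.
Proof.
move=> PQ; pose f := Radon_Nikodym_SigmaFinite.f P Q.
have fE x : (fine (f x))%:E = f x.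
  by rewrite fineK//; exact: Radon_Nikodym_SigmaFinite.f_fin_num.
exists (fine \o f); split.
- apply/measurable_EFinP; rewrite (_ : _ \o _ = f); last exact/funext.
  exact: measurable_int (Radon_Nikodym_SigmaFinite.f_integrable PQ).
- by move=> x; apply: fine_ge0; exact: Radon_Nikodym_SigmaFinite.f_ge0.
- move=> A mA; rewrite (Radon_Nikodym_SigmaFinite.f_integral PQ)//.
  by apply: eq_integral => x _; rewrite /= fE.
Qed.

Lemma density_integrable f P Q :
  is_density f P Q -> Q.-integrable [set: T] (EFin \o f).
Proof.
move=> [mf f0 PE]; apply/integrableP; split; first exact/measurable_EFinP.
under eq_integral do rewrite /= ger0_norm//.
by rewrite -PE// probability_setT ltry.
Qed.

Lemma density_ae_eq f P Q (g : T -> \bar R) : is_density f P Q ->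
  measurable_fun [set: T] g ->
  (forall A, measurable A -> P A = \int[Q]_(x in A) g x) ->
  ae_eq Q [set: T] (EFin \o f) g.
Proof.
move=> df mg PE; apply: integral_ae_eq => //; first exact: density_integrable df.
by move=> A _ mA; have [_ _ <-] := df; rewrite ?PE.
Qed.

Lemma density_integral f P Q g : is_density f P Q ->
  measurable_fun [set: T] g -> (forall x, 0 <= g x) ->
  \int[P]_x g x = \int[Q]_x (g x * (f x)%:E).
Proof.
move=> df mg g0; have PQ := density_dominates df; have [mf f0 _] := df.
rewrite -(Radon_Nikodym_SigmaFinite.change_of_variables PQ)//.
have mRN : measurable_fun [set: T] (Radon_Nikodym_SigmaFinite.f P Q).
  exact: measurable_int (Radon_Nikodym_SigmaFinite.f_integrable PQ).
apply: ge0_ae_eq_integral => //.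
- exact: emeasurable_funM.
- by apply: emeasurable_funM => //; exact/measurable_EFinP.
- by move=> x _; rewrite mule_ge0//; exact: Radon_Nikodym_SigmaFinite.f_ge0.
- by move=> x _; rewrite mule_ge0// lee_fin.
- apply: ae_eqe_mul2l; apply: ae_eq_sym; apply: (density_ae_eq df) => //.
  exact: Radon_Nikodym_SigmaFinite.f_integral.
Qed.

(** Integrates (f - 1)^2 + 2 f = f^2 + 1. All terms are nonnegative, so the second moment may be
    infinite. *)
Lemma chi2_density f P Q : is_density f P Q ->
  chi2 P Q + 1 = \int[Q]_x ((f x) ^+ 2)%:E.
Proof.
move=> df; have PQ := density_dominates df; have [mf f0 PE] := df.
have ae : ae_eq Q [set: T] (EFin \o f) ('d (charge_of_finite_measure P) '/d Q).
  apply: (density_ae_eq df) => // A mA.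
  by rewrite -Radon_Nikodym_integral.
have -> : chi2 P Q = \int[Q]_x ((f x - 1) ^+ 2)%:E.
  rewrite /chi2 asboolT//; apply: ae_eq_integral => //.
  - under eq_fun do rewrite expe2.
    by apply: emeasurable_funM; apply: emeasurable_funB.
  - by apply/measurable_EFinP; apply: measurable_funX; apply: measurable_funB.
  - by apply: ae_eq_sym; apply: filterS ae => x /(_ I) /= <- _; rewrite EFin_expe EFinB.
have I1 : \int[Q]_x (1 : R)%:E = 1.
  by rewrite integral_cst// mul1e; exact: probability_setT.
have If : \int[Q]_x (f x)%:E = 1 by rewrite -PE// probability_setT.
rewrite -[LHS](@addeK _ 1)// -[RHS](@addeK _ 1)//; congr (_ - _).
rewrite -addeA.
have -> : 1 + 1 = \int[Q]_x (2 * f x)%:E :> \bar R.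
  under eq_integral do rewrite EFinM.
  rewrite ge0_integralZl//; last 2 first.
    by apply/measurable_EFinP.
    by move=> x _; rewrite lee_fin.
  by rewrite If mule1.
rewrite -[X in _ = _ + X]I1 -!ge0_integralD//.
- by apply: eq_integral => x _; rewrite -!EFinD; congr EFin; ring.
- by move=> x _; rewrite lee_fin sqr_ge0.
- by apply/measurable_EFinP; apply: measurable_funX.
- by move=> x _; rewrite lee_fin sqr_ge0.
- by apply/measurable_EFinP; apply: measurable_funX; apply: measurable_funB.
- by move=> x _; rewrite lee_fin mulr_ge0.
- by apply/measurable_EFinP; apply: measurable_funM.
Qed.

Lemma prob_integral_cst P (c : \bar R) : \int[P]_x cst c x = c.
Proof.
by rewrite integral_cst// -[RHS]mule1; congr (_ * _); exact: probability_setT.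
Qed.

Lemma chi2_ge0 P Q : 0 <= chi2 P Q.
Proof.
rewrite /chi2; case: asboolP => // PQ; apply: integral_ge0 => x _.
rewrite -(fineK (Radon_Nikodym_fin_num x _))//.
by rewrite -EFinB -EFin_expe lee_fin sqr_ge0.
Qed.

(** Integrates 2 f phi <= f^2 + phi^2 for a density f. For fixed [phi] the two integrals are linear
    in [P] and [Q], so the bound passes to mixtures and yields measurable minorants of the
    divergence. *)
Lemma chi2_variational (phi : T -> R) P Q :
  measurable_fun [set: T] phi -> (forall x, (0 <= phi x)%R) ->
  2%:E * \int[P]_x (phi x)%:E <= chi2 P Q + 1 + \int[Q]_x (phi x ^+ 2)%:E.
Proof.
move=> mphi phi0.
have I0 : 0 <= \int[Q]_x (phi x ^+ 2)%:E.
  by apply: integral_ge0 => x _; rewrite lee_fin sqr_ge0.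
have [PQ|PQ] := pselect (P `<< Q); last first.
  have -> : chi2 P Q = +oo by rewrite /chi2 (asboolF PQ).
  rewrite addye ?leey// gt_eqF//.
  by rewrite (lt_le_trans _ I0)// ltNy0.
have [f df] := exists_density PQ; have [mf f0 PE] := df.
rewrite (chi2_density df) (density_integral df); last 2 first.
  exact/measurable_EFinP.
  by move=> x; rewrite lee_fin.
rewrite -ge0_integralZl//; last 2 first.
  by apply: emeasurable_funM; exact/measurable_EFinP.
  by move=> x _; rewrite mule_ge0 ?lee_fin.
rewrite -ge0_integralD//; last 4 first.
  by move=> x _; rewrite lee_fin sqr_ge0.
  by apply/measurable_EFinP; apply: measurable_funX.
  by move=> x _; rewrite lee_fin sqr_ge0.
  by apply/measurable_EFinP; apply: measurable_funX.
apply: ge0_le_integral => //.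
- by move=> x _; rewrite !mule_ge0 ?lee_fin.
- by apply: measurable_funeM; apply: emeasurable_funM; exact/measurable_EFinP.
- by apply/measurable_EFinP; apply: measurable_funD; apply: measurable_funX.
- move=> x _; rewrite -!EFinM -EFinD lee_fin.
  by have := sqr_ge0 (f x - phi x); lra.
Qed.

End density.

(** * Integration against mixtures, and lower integrals *)

Section unif_mix_integral.
Context d (T : measurableType d) (R : realType) (I : finType).

Lemma unif_mix_integral (i0 : I) (P : I -> probability T R) (g : T -> \bar R) :
  measurable_fun [set: T] g -> (forall x, 0 <= g x) ->
  \int[unif_mix i0 P]_x g x = (#|I|%:R^-1)%:E * \sum_i \int[P i]_x g x.
Proof.
move=> mg g0.
have k0 : (0 <= #|I|%:R^-1 :> R)%R by [].
pose m_ k : {measure set T -> \bar R} := P (nth i0 (enum I) k).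
transitivity (\int[mscale (NngNum k0) (msum m_ #|I|)]_x g x).
  apply: eq_measure_integral => A mA _.
  rewrite /mscale /= /unif_mix /msum; congr (_ * _).
  rewrite cardE -(big_enum _ _ _ (fun i => P i A)) /= (big_nth i0) big_mkord.
  by [].
rewrite ge0_integral_mscale//; congr (_ * _).
rewrite ge0_integral_measure_sum// cardE.
rewrite -(big_enum _ _ _ (fun i => \int[P i]_x g x)) /= (big_nth i0) big_mkord.
by [].
Qed.

End unif_mix_integral.

Section lower_integral.
Context d (T : measurableType d) (R : realType).
Variable mu : {measure set T -> \bar R}.

Import HBNNSimple.

(* No measurability is assumed: the integral of a nonnegative function is the
   supremum of the integrals of the simple functions below it. *)
Lemma le_lower_integral (f g : T -> \bar R) :
  (forall x, 0 <= f x) -> (forall x, f x <= g x) ->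
  \int[mu]_x f x <= \int[mu]_x g x.
Proof.
move=> f0 fg; have g0 x : 0 <= g x by exact: le_trans (f0 x) (fg x).
rewrite !ge0_integralTE//; apply: ereal_sup_le => _ [h hf <-].
by exists h => // x; exact: le_trans (hf x) (fg x).
Qed.

(** A simple function h below [g] satisfies h <= c on a measurable set containing [A], which has
    full measure. Neither [g] nor [A] has to be measurable. *)
Lemma lower_integral_le_bound (g : T -> \bar R) (A : set T) (c : R) :
  (forall x, 0 <= g x) -> (0 <= c)%R ->
  (forall x, A x -> g x <= c%:E) ->
  (forall B, measurable B -> A `<=` B -> mu B = mu [set: T]) ->
  mu [set: T] < +oo ->
  \int[mu]_x g x <= c%:E * mu [set: T].
Proof.
move=> g0 c0 gc Afull mufin; rewrite ge0_integralTE//.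
apply: ge_ereal_sup => _ [h hg <-].
rewrite -integralT_nnsfun -integral_cst//.
have mB : measurable [set x | ((h x)%:E <= c%:E)].
  rewrite -[X in measurable X]setTI.
  by apply: measurable_lee => //; exact/measurable_EFinP.
apply: ae_ge0_le_integral => //.
- by move=> x _; rewrite lee_fin.
- exact/measurable_EFinP.
pose B := [set x | ((h x)%:E <= c%:E)].
have muB : mu B = mu [set: T].
  by apply: Afull => // x /gc; exact: le_trans (hg x).
have mufin' : mu [set: T] \is a fin_num by rewrite ge0_fin_numE.
exists (~` B); split.
- exact: measurableC.
- have -> : mu (~` B) = mu [set: T] - mu B by rewrite -setTD measureD ?setTI.
  by rewrite muB subee.
- by move=> x /= /not_implyP[_].
Qed.

End lower_integral.

Section prior_mix_integral.
Context d (T : measurableType d) (R : realType).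
Variable rho : probability (pprobability T R) R.
Import HBNNSimple.

Lemma measurable_prob_integral (g : T -> \bar R) :
  measurable_fun [set: T] g -> (forall x, 0 <= g x) ->
  measurable_fun [set: pprobability T R]
    (fun P => \int[(P : probability T R)]_x g x).
Proof.
move=> mg g0.
apply: (measurable_fun_integral_kernel (l := fun P : pprobability T R =>
  (P : probability T R) : {measure set T -> \bar R})) => //.
by move=> U mU; exact: measurable_prob_ev.
Qed.

(** For indicators this is the definition of the mixture; simple functions and monotone convergence
    do the rest. *)
Lemma prior_mix_integral (g : T -> \bar R) :
  measurable_fun [set: T] g -> (forall x, 0 <= g x) ->
  \int[prior_mix rho]_x g x = \int[rho]_P \int[(P : probability T R)]_x g x.
Proof.
move=> mg g0.
pose h := nnsfun_approx measurableT mg.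
have mh n : measurable_fun [set: T] (EFin \o h n) by exact/measurable_EFinP.
have h0 n x : 0 <= (EFin \o h n) x by rewrite lee_fin.
have ndh x : {homo (fun n => (EFin \o h n) x) : n m / (n <= m)%O >-> n <= m}.
  by move=> *; rewrite lee_fin; exact/lefP/nd_nnsfun_approx.
have mono (mu : {measure set T -> \bar R}) :
    \int[mu]_x g x = limn (fun n => \int[mu]_x (EFin \o h n) x).
  rewrite -monotone_convergence//; apply: eq_integral => t _.
  by apply/esym/cvg_lim => //; exact: cvg_nnsfun_approx.
rewrite (mono (prior_mix rho)).
transitivity (limn (fun n =>
    \int[rho]_P \int[(P : probability T R)]_x (EFin \o h n) x)).
  apply: congr_lim; apply/funext => n.
  rewrite integralT_nnsfun sintegralE.
  under [RHS]eq_integral do rewrite integralT_nnsfun sintegralE.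
  rewrite ge0_integral_fsum//; last 2 first.
    by move=> r; apply: measurable_funeM; exact: measurable_prob_ev.
    by move=> r P _; exact: nnsfun_mulemu_ge0.
  apply: eq_fsbigr => r rh; rewrite /prior_mix.
  have r0 : (0 <= r)%R by move: rh; rewrite inE => -[t _ <-].
  by rewrite ge0_integralZl//; exact: measurable_prob_ev.
rewrite -[LHS]monotone_convergence//; last 3 first.
  by move=> n; exact: measurable_prob_integral.
  by move=> n P _; exact: integral_ge0.
  by move=> P _ m n mn; apply: ge0_le_integral => // t _; exact: ndh.
by apply: eq_integral => P _; rewrite mono.
Qed.

End prior_mix_integral.

(** * The chi^2 capacity against the diameter and against averages *)

Section capacity.
Context d (T : measurableType d) (R : realType).
Variable F : set (probability T R).

Lemma integral_scale_indic (mu : {measure set T -> \bar R}) (c : R) (A : set T) :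
  (0 <= c)%R -> measurable A -> \int[mu]_x (c * \1_A x)%:E = c%:E * mu A.
Proof.
move=> c0 mA; under eq_integral do rewrite EFinM.
rewrite ge0_integralZl//; last by apply/measurable_EFinP; exact: measurable_indic.
by rewrite integral_indic// setIT.
Qed.

(** Converse of [chi2_variational]. Large multiples of the indicator of a null set show domination;
    truncated densities bound the second moment. *)
Lemma chi2_le (P Q : probability T R) (D : R) :
  (0 <= D)%R ->
  (forall phi : T -> R, measurable_fun [set: T] phi -> (forall x, (0 <= phi x)%R) ->
    2%:E * \int[P]_x (phi x)%:E <= D%:E + 1 + \int[Q]_x (phi x ^+ 2)%:E) ->
  chi2 P Q <= D%:E.
Proof.
move=> D0 H.
have PQ : P `<< Q.
  apply/null_content_dominatesP => A mA QA0.
  apply/eqP; rewrite -measure_le0; apply/lee_addgt0Pr => e e0; rewrite add0e.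
  (* With this multiple the hypothesis reads 2 s P(A) <= D + 1, that is P(A) <= e / 2. *)
  pose s : R := ((D + 1) / e)%R.
  have s0 : (0 < s)%R by rewrite divr_gt0// ltr_wpDl.
  have key : 2%:E * (s%:E * P A) <= D%:E + 1.
    have := H (fun x => s * \1_A x)%R.
    rewrite (integral_scale_indic _ (ltW s0) mA).
    have -> : \int[Q]_x ((s * \1_A x) ^+ 2)%:E = 0.
      rewrite (eq_integral (fun x => (s ^+ 2 * \1_A x)%:E)); last first.
        move=> x _; congr EFin; rewrite exprMn; congr (_ * _)%R.
        by rewrite indicE; case: (x \in A); rewrite ?expr1n ?expr0n.
      by rewrite integral_scale_indic ?sqr_ge0// QA0 mule0.
    rewrite adde0; apply => [|x]; last by rewrite mulr_ge0// ltW.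
    by apply: measurable_funM => //; exact: measurable_indic.
  have PAfin : P A \is a fin_num by exact: fin_num_measure.
  suff : P A <= e%:E by [].
  have PA0 : 0 <= P A by [].
  move: key PAfin PA0; case: (P A) => [p| |]//.
  rewrite -!EFinM -EFinD !lee_fin => key _ p0.
  move: key; have -> : (2 * (s * p) = (D + 1) * (2 * p / e))%R.
    by rewrite /s; field; rewrite gt_eqF.
  rewrite ger_pMr ?ltr_wpDl// ler_pdivrMr// mul1r; lra.
have [f df] := exists_density PQ; have [mf f0 PE] := df.
(* The test function is min(f, n). The integral of f min(f, n) is then finite and dominates that of
   min(f, n)^2, so it can be cancelled once; monotone convergence removes the truncation. *)
pose fM n : T -> R := fun x => Num.min (f x) n%:R.
have mfM n : measurable_fun [set: T] (fM n) by apply: measurable_minr.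
have fM0 n x : (0 <= fM n x)%R by rewrite /fM le_min f0 ler0n.
suff : chi2 P Q + 1 <= D%:E + 1 by rewrite leeD2rE.
rewrite (chi2_density df).
pose g n x : \bar R := (f x * fM n x)%:E.
have mg n : measurable_fun [set: T] (g n).
  by apply/measurable_EFinP; apply: measurable_funM.
have g0 n x : 0 <= g n x by rewrite lee_fin mulr_ge0.
have ndg x : {homo (fun n => g n x) : n m / (n <= m)%O >-> n <= m}.
  move=> m n mn; have {}mn : (m <= n)%N := mn; rewrite lee_fin ler_wpM2l//.
  by rewrite /fM le_min ge_min lexx /= ge_min ler_nat mn orbT.
have -> : \int[Q]_x (f x ^+ 2)%:E = limn (fun n => \int[Q]_x g n x).
  rewrite -monotone_convergence//.
  apply: eq_integral => x _; apply/esym/cvg_lim => //.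
  apply: cvg_near_cst; near=> n.
  rewrite /g /fM min_l ?expr2//.
  by near: n; exact: nbhs_infty_ger.
apply: lime_le.
  by apply: ereal_nondecreasing_is_cvgn => m n mn;
    apply: ge0_le_integral => // x _; exact: ndg.
apply: nearW => n.
have gP : \int[Q]_x g n x = \int[P]_x (fM n x)%:E.
  rewrite (density_integral df) //; last 2 first.
    exact/measurable_EFinP.
    by move=> x; rewrite lee_fin.
  by apply: eq_integral => x _; rewrite /g mulrC EFinM.
have gle : \int[Q]_x g n x <= n%:R%:E.
  rewrite gP; apply: (@le_trans _ _ (\int[P]_x (cst n%:R%:E x))).
    apply: ge0_le_integral => //.
    - by move=> x _; rewrite lee_fin.
    - exact/measurable_EFinP.
    - by move=> x _; rewrite lee_fin /fM ge_min lexx orbT.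
  by rewrite prob_integral_cst.
have gfin : \int[Q]_x g n x \is a fin_num.
  rewrite ge0_fin_numE; first exact: le_lt_trans gle (ltry _).
  exact: integral_ge0.
have phile : \int[Q]_x (fM n x ^+ 2)%:E <= \int[Q]_x g n x.
  apply: ge0_le_integral => //.
  - by move=> x _; rewrite lee_fin sqr_ge0.
  - by apply/measurable_EFinP; apply: measurable_funX.
  - by move=> x _; rewrite lee_fin expr2 ler_wpM2r// /fM ge_min lexx.
have := H (fM n) (mfM n) (fM0 n); rewrite -gP => Hn.
have {Hn phile} : 2%:E * \int[Q]_x g n x <= D%:E + 1 + \int[Q]_x g n x.
  by apply: le_trans Hn _; rewrite leeD2l.
rewrite -(fineK gfin) -EFinM -!EFinD !lee_fin; lra.
Unshelve. all: by end_near. Qed.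

(** For a fixed test function the variational inequality is linear in the second measure, and it
    holds on a measurable set of measures containing [F], hence almost surely under the prior. It
    can thus be integrated. *)
Lemma chi2_prior_mix_le (rho : probability (pprobability T R) R) (D : R) P :
  (0 <= D)%R -> prior F rho -> (forall Q, F Q -> chi2 P Q <= D%:E) ->
  chi2 P (prior_mix rho) <= D%:E.
Proof.
move=> D0 Frho PD; apply: chi2_le => // phi mphi phi0.
have mphi2 : measurable_fun [set: T] (fun x => (phi x ^+ 2)%:E).
  by apply/measurable_EFinP; apply: measurable_funX.
have phi20 x : 0 <= (phi x ^+ 2)%:E by rewrite lee_fin sqr_ge0.
rewrite prior_mix_integral//.
set c := 2%:E * _.
have mI := measurable_prob_integral mphi2 phi20.
have c0 : 0 <= c.
  by rewrite mule_ge0//; apply: integral_ge0 => x _; rewrite lee_fin.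
have -> : c = \int[rho]_P (cst c P) by rewrite prob_integral_cst.
have -> : D%:E + 1 = \int[rho]_P (cst (D%:E + 1) P).
  by rewrite prob_integral_cst.
have D1 : 0 <= D%:E + 1 by rewrite adde_ge0.
rewrite -ge0_integralD//; last by move=> P' _; apply: integral_ge0.
pose A := [set P' : pprobability T R | c <= D%:E + 1 +
  \int[(P' : probability T R)]_x (phi x ^+ 2)%:E].
have mA : measurable A.
  rewrite -[X in measurable X]setTI; apply: measurable_lee => //.
  exact: emeasurable_funD.
apply: ae_ge0_le_integral => //.
- by move=> P' _; rewrite adde_ge0// integral_ge0.
- exact: emeasurable_funD.
- exists (~` A); split.
  + exact: measurableC.
  + have FA : F `<=` A; last first.
      apply: etrans (probability_setC rho mA) _.
      by apply: etrans (congr1 (fun z => 1 - z) (Frho A mA FA)) _; rewrite subee.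
    move=> Q' FQ'; rewrite /A /=; apply: le_trans (chi2_variational P Q' mphi phi0) _.
    by rewrite leeD2r// leeD2r// PD.
  + by move=> P' /= /not_implyP[_].
Qed.

(** For each prior the integrand is at most the diameter on [F], by [chi2_prior_mix_le];
    [lower_integral_le_bound] copes with the missing measurability. *)
Lemma capacity_le_diameter : F !=set0 -> chi2_diameter F < +oo ->
  chi2_capacity F <= chi2_diameter F.
Proof.
move=> [P0 FP0] Dfin.
have Dub P Q : F P -> F Q -> chi2 P Q <= chi2_diameter F.
  by move=> FP FQ; apply: ereal_sup_ubound; exists (P, Q).
have D0 : 0 <= chi2_diameter F by apply: le_trans (chi2_ge0 P0 P0) (Dub _ _ _ _).
have Dr : chi2_diameter F \is a fin_num by rewrite ge0_fin_numE.
apply: ge_ereal_sup => _ [rho Frho <-].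
rewrite -(fineK Dr); set D := fine _.
have DD0 : (0 <= D)%R by apply: fine_ge0.
rewrite -[leRHS]mule1 -(probability_setT rho).
apply: (@lower_integral_le_bound _ _ _ rho
  (fun P : pprobability T R => chi2 P (prior_mix rho)) F D) => //.
- by move=> P; exact: chi2_ge0.
- move=> P FP; apply: chi2_prior_mix_le => // Q FQ.
  by rewrite fineK//; exact: Dub.
- move=> B mB FB; exact: etrans (Frho B mB FB) (esym (probability_setT rho)).
- apply: (@le_lt_trans _ _ 1); last exact: ltry.
  by rewrite le_eqVlt; apply/orP; left; apply/eqP; exact: probability_setT.
Qed.

(** The prior is uniform on the points [P i]. Since the divergence need not be measurable, its lower
    integral is bounded through a measurable minorant that takes at least the required values at
    these points. *)
Lemma avg_chi2_le_capacity (I : finType) (i0 : I) (P : I -> probability T R)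
    (f : I -> T -> R) (a : I -> R) : (forall i, F (P i)) ->
  (forall i, is_density (f i) (P i) (unif_mix i0 P)) ->
  (forall i, \int[unif_mix i0 P]_x (f i x ^+ 2)%:E = (a i)%:E) ->
  (#|I|%:R^-1 * \sum_i (a i - 1))%:E <= chi2_capacity F.
Proof.
move=> FP df aE.
pose rho : probability (pprobability T R) R := unif_mix i0
  (fun i => dirac (P i : pprobability T R) : probability (pprobability T R) R).
have Frho : prior F rho.
  move=> A mA FA; rewrite -(probability_setT rho) /rho /unif_mix; congr (_ * _).
  have d1 i (B : set (pprobability T R)) : B (P i) ->
      (dirac (P i : pprobability T R) : probability (pprobability T R) R) B = 1.
    by move=> BP; rewrite /= /dirac indicE mem_set.
  apply: eq_bigr => i _; transitivity (1 : \bar R); last exact/esym/d1.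
  by apply: d1; exact: FA.
have mixE A : measurable A -> unif_mix i0 P A = prior_mix rho A.
  move=> mA; rewrite /prior_mix unif_mix_integral//; last exact: measurable_prob_ev.
  congr (_ * _); apply: eq_bigr => i _.
  rewrite integral_dirac//; last exact: measurable_prob_ev.
  by rewrite diracT mul1e.
(* The variational lower bound with test function [f i]; at [P i] it equals [a i - 1], as the
   integral of [f i] under [P i] is [a i]. *)
pose t i (P' : pprobability T R) : \bar R :=
  2%:E * \int[(P' : probability T R)]_x (f i x)%:E - (1 + a i)%:E.
have mt i : measurable_fun [set: pprobability T R] (t i).
  have [mf f0 _] := df i.
  apply: emeasurable_funB => //; apply: measurable_funeM.
  by apply: measurable_prob_integral => [|x]; [exact/measurable_EFinP|rewrite lee_fin].
pose h P' := \big[maxe/0]_i t i P'.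
have mh : measurable_fun [set: pprobability T R] h.
  rewrite /h; elim: (index_enum I) => [|i s IH].
    by under eq_fun do rewrite big_nil; exact: measurable_cst.
  by under eq_fun do rewrite big_cons; exact: measurable_maxe.
have h0 P' : 0 <= h P' by exact: bigmax_ge_id.
have hle P' : h P' <= chi2 P' (prior_mix rho).
  apply/bigmax_leP; split; first exact: chi2_ge0.
  move=> i _; have [mf f0 _] := df i.
  rewrite /t leeBlDr// (EFinD 1 (a i)) addeA.
  have := chi2_variational P' (prior_mix rho) mf f0.
  suff -> : \int[prior_mix rho]_x (f i x ^+ 2)%:E = (a i)%:E by [].
  by rewrite -aE; apply: eq_measure_integral => A mA _; rewrite [RHS]mixE.
have hge i : (a i - 1)%:E <= h (P i).
  apply: (@le_trans _ _ (t i (P i))); last exact: le_bigmax.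
  have [mf f0 _] := df i.
  rewrite /t (density_integral (df i)); last 2 first.
    exact/measurable_EFinP.
    by move=> x; rewrite lee_fin.
  rewrite (eq_integral (fun x => (f i x ^+ 2)%:E)) => [|x _].
    by rewrite aE -EFinM -EFinB lee_fin; lra.
  by rewrite -EFinM expr2.
apply: (@le_trans _ _ (\int[rho]_P chi2 P (prior_mix rho))); last first.
  by apply: ereal_sup_ubound; exists rho.
apply: le_trans (le_lower_integral _ h0 hle).
rewrite unif_mix_integral// EFinM -sumEFin lee_wpmul2l ?lee_fin//.
apply: lee_sum => i _; rewrite integral_dirac// diracT mul1e.
exact: hge.
Qed.

End capacity.

(** * Integrals and densities of product measures *)

Section product_density.
Context d (T : measurableType d) (R : realType).

Lemma measurable_prod_tnth n (f : 'I_n -> T -> R) :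
  (forall i, measurable_fun [set: T] (f i)) ->
  measurable_fun [set: n.-tuple T] (fun t => \prod_i f i (tnth t i))%R.
Proof.
move=> mf; apply: measurable_prod => i _.
by apply: (measurableT_comp (mf i)); exact: measurable_tnth.
Qed.

Lemma product_prob_integralS n (P : 'I_n.+1 -> probability T R)
    (g : n.+1.-tuple T -> \bar R) :
  measurable_fun [set: n.+1.-tuple T] g -> (forall t, 0 <= g t) ->
  \int[product_prob P]_t g t =
  \int[P ord0]_x \int[product_prob (fun i => P (lift ord0 i))]_t
    g (tuple_cons (x, t)).
Proof.
move=> mg g0.
rewrite [product_prob P]/= /distribution ge0_integral_pushforward// preimage_setT.
transitivity (\int[P ord0 \x product_prob (fun i => P (lift ord0 i))]_z
    (g \o @tuple_cons _ T n) z).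
  exact: eq_measure_integral.
rewrite fubini_tonelli1//; last by move=> z; exact: g0.
by apply: measurableT_comp => //; exact: measurable_tuple_cons.
Qed.

Lemma product_prob_integral_prod n (P : 'I_n -> probability T R)
    (f : 'I_n -> T -> R) :
  (forall i, measurable_fun [set: T] (f i)) -> (forall i x, (0 <= f i x)%R) ->
  \int[product_prob P]_t (\prod_i f i (tnth t i))%:E =
  \prod_i \int[P i]_x (f i x)%:E.
Proof.
elim: n P f => [|n IH] P f mf f0.
  under eq_integral do rewrite big_ord0.
  by rewrite big_ord0; exact: prob_integral_cst.
rewrite product_prob_integralS//; last 2 first.
- by apply/measurable_EFinP; exact: measurable_prod_tnth.
- by move=> t; rewrite lee_fin prodr_ge0.
have inner x : \int[product_prob (fun i => P (lift ord0 i))]_t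
    (\prod_i f i (tnth (tuple_cons (x, t)) i))%:E =
    (f ord0 x)%:E * \prod_i \int[P (lift ord0 i)]_x (f (lift ord0 i) x)%:E.
  have mS : measurable_fun [set: n.-tuple T]
      (fun t => (\prod_i f (lift ord0 i) (tnth t i))%:E).
    apply/measurable_EFinP.
    exact: (measurable_prod_tnth (f := fun i => f (lift ord0 i))).
  have S0 (t : n.-tuple T) : 0 <= (\prod_i f (lift ord0 i) (tnth t i))%:E.
    by rewrite lee_fin prodr_ge0.
  rewrite -IH// -ge0_integralZl ?lee_fin//.
  apply: eq_integral => t _; rewrite -EFinM big_ord_recl tnth0 /=.
  by congr (_ * _)%:E; apply: eq_bigr => i _; rewrite tnthS.
under eq_integral do rewrite inner.
rewrite big_ord_recl ge0_integralZr//.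
- by apply/measurable_EFinP.
- by move=> x _; rewrite lee_fin.
- by apply: prode_ge0 => i _; apply: integral_ge0 => x _; rewrite lee_fin.
Qed.

Lemma product_prob_density n (P Q : 'I_n -> probability T R)
    (f : 'I_n -> T -> R) (g : n.-tuple T -> \bar R) :
  (forall i, is_density (f i) (P i) (Q i)) ->
  measurable_fun [set: n.-tuple T] g -> (forall t, 0 <= g t) ->
  \int[product_prob P]_t g t =
  \int[product_prob Q]_t (g t * (\prod_i f i (tnth t i))%:E).
Proof.
elim: n P Q f g => [|n IH] P Q f g df mg g0.
  by apply: eq_integral => t _; rewrite big_ord0 mule1.
have mf i : measurable_fun [set: T] (f i) by have [] := df i.
have f0 i x : (0 <= f i x)%R by have [] := df i.
have mgc : measurable_fun [set: T * n.-tuple T] (g \o @tuple_cons _ T n).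
  by apply: measurableT_comp => //; exact: measurable_tuple_cons.
have mgx x : measurable_fun [set: n.-tuple T] (fun t => g (tuple_cons (x, t))).
  by apply: (measurableT_comp mgc); exact: pair1_measurable.
rewrite product_prob_integralS// [RHS]product_prob_integralS//; last 2 first.
- apply: emeasurable_funM => //.
  by apply/measurable_EFinP; exact: measurable_prod_tnth.
- by move=> t; rewrite mule_ge0// lee_fin prodr_ge0.
rewrite (density_integral (df ord0)); last 2 first.
- apply: (measurable_fun_fubini_tonelli_F (g \o @tuple_cons _ T n)) => //.
  by move=> z; exact: g0.
- by move=> x; apply: integral_ge0.
apply: eq_integral => x _.
rewrite (IH _ (fun i => Q (lift ord0 i)) (fun i => f (lift ord0 i)))//.
rewrite -ge0_integralZr//; last 3 first.
- apply: emeasurable_funM => //.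
  apply/measurable_EFinP.
  exact: (measurable_prod_tnth (f := fun i => f (lift ord0 i))).
- by move=> t _; rewrite mule_ge0// lee_fin prodr_ge0.
- by rewrite lee_fin.
apply: eq_integral => t _; rewrite big_ord_recl tnth0.
under [in RHS]eq_bigr do rewrite tnthS.
by rewrite -muleA -EFinM mulrC.
Qed.

End product_density.

(** * The chi^2 divergence of the permutation mixture as a double permutation sum *)

Section perm_mixture_chi2.
Context d (T : measurableType d) (R : realType) (n : nat) (n_gt0 : (0 < n)%N).
Variables (P : 'I_n -> probability T R) (f : 'I_n -> T -> R) (a : 'I_n -> 'I_n -> R).
Let Q := unif_mix (Ordinal n_gt0) P.
Hypothesis df : forall i, is_density (f i) (P i) Q.
Hypothesis aE : forall i j, \int[Q]_x (f i x * f j x)%:E = (a i j)%:E.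

Let L (t : n.-tuple T) : R :=
  (n`!%:R^-1 * \sum_(s : 'S_n) \prod_i f (s i) (tnth t i))%R.

Lemma perm_mixture_density :
  is_density L (perm_mixture P) (iid_mixture P n_gt0).
Proof.
have mf i : measurable_fun [set: T] (f i) by have [] := df i.
have f0 i x : (0 <= f i x)%R by have [] := df i.
have ms (s : 'S_n) : measurable_fun [set: n.-tuple T]
    (fun t => \prod_i f (s i) (tnth t i))%R.
  exact: (measurable_prod_tnth (f := fun i => f (s i))).
split.
- by apply: measurable_funM => //; apply: measurable_sum => s; exact: ms.
- move=> t; rewrite mulr_ge0 ?invr_ge0//; apply: sumr_ge0 => s _.
  exact: prodr_ge0.
- move=> A mA.
  have mA1 : measurable_fun [set: n.-tuple T] (fun t => (\1_A t)%:E : \bar R).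
    by apply/measurable_EFinP; exact: measurable_indic.
  have A0 (t : n.-tuple T) : 0 <= (\1_A t)%:E :> \bar R by rewrite lee_fin.
  have E (s : 'S_n) : product_prob (fun i => P (s i)) A =
      \int[iid_mixture P n_gt0]_(t in A) (\prod_i f (s i) (tnth t i))%:E.
    transitivity (\int[product_prob (fun i => P (s i))]_t (\1_A t)%:E).
      by rewrite integral_indic// setIT.
    rewrite (product_prob_density (Q := fun=> Q) (f := fun i => f (s i)))//.
    rewrite [RHS]integral_mkcond; apply: eq_integral => t _.
    by rewrite patchE indicE; case: (t \in A); rewrite ?mul1e ?mul0e.
  rewrite /perm_mixture /= /unif_mix; under eq_bigr do rewrite E.
  rewrite -ge0_integral_sum//; last 2 first.
    by move=> s; apply: measurable_funTS; exact/measurable_EFinP.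
    by move=> s t _; rewrite lee_fin prodr_ge0.
  rewrite card_Sn -ge0_integralZl//; last 2 first.
  - by apply: emeasurable_sum => s; apply: measurable_funTS; exact/measurable_EFinP.
  - by move=> t _; apply: sume_ge0 => s _; rewrite lee_fin prodr_ge0.
  by apply: eq_integral => t _; rewrite /L EFinM -sumEFin.
Qed.

(** The square of the density [L] is a double sum over permutations of products over coordinates,
    and each such product integrates factor by factor under the product measure. *)
Lemma perm_mixture_chi2 :
  chi2 (perm_mixture P) (iid_mixture P n_gt0) + 1 =
  (n`!%:R ^- 2 * \sum_(s : 'S_n) \sum_(u : 'S_n) \prod_i a (s i) (u i))%:E.
Proof.
have mf i : measurable_fun [set: T] (f i) by have [] := df i.
have f0 i x : (0 <= f i x)%R by have [] := df i.
rewrite (chi2_density perm_mixture_density).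
have mp (s u : 'S_n) : measurable_fun [set: n.-tuple T]
    (fun t => \prod_i (f (s i) (tnth t i) * f (u i) (tnth t i)))%R.
  apply: (measurable_prod_tnth (f := fun i x => f (s i) x * f (u i) x)%R) => i.
  exact: measurable_funM.
have p0 (s u : 'S_n) t :
    (0 <= \prod_i (f (s i) (tnth t i) * f (u i) (tnth t i)))%R.
  by apply: prodr_ge0 => i _; exact: mulr_ge0.
transitivity (\int[iid_mixture P n_gt0]_t ((n`!%:R ^- 2)%:E *
    \sum_(s : 'S_n) \sum_(u : 'S_n)
      (\prod_i (f (s i) (tnth t i) * f (u i) (tnth t i)))%:E)).
  apply: eq_integral => t _; rewrite /L exprMn exprVn EFinM; congr (_ * _).
  rewrite expr2 mulr_suml -sumEFin; apply: eq_bigr => s _.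
  rewrite mulr_sumr -sumEFin; apply: eq_bigr => u _.
  by rewrite -big_split.
rewrite ge0_integralZl//; last 2 first.
- apply: emeasurable_sum => s; apply: emeasurable_sum => u.
  exact/measurable_EFinP.
- by move=> t _; apply: sume_ge0 => s _; apply: sume_ge0 => u _; rewrite lee_fin.
rewrite EFinM; congr (_ * _).
rewrite ge0_integral_sum//; last 2 first.
- by move=> s; apply: emeasurable_sum => u; exact/measurable_EFinP.
- by move=> s t _; apply: sume_ge0 => u _; rewrite lee_fin.
rewrite -sumEFin; apply: eq_bigr => s _.
rewrite ge0_integral_sum//; last 2 first.
- by move=> u; exact/measurable_EFinP.
- by move=> u t _; rewrite lee_fin.
rewrite -sumEFin; apply: eq_bigr => u _.
rewrite (product_prob_integral_prod (fun=> Q)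
  (f := fun i x => f (s i) x * f (u i) x)%R).
- by rewrite -prodEFin; apply: eq_bigr => i _; exact: aE.
- by move=> i; exact: measurable_funM.
- by move=> i x; exact: mulr_ge0.
Qed.

End perm_mixture_chi2.

(** * Lower bounds on the overlap of two densities *)

Section overlap.
Context d (T : measurableType d) (R : realType).
Variables (P1 P2 Q : probability T R) (f1 f2 : T -> R).
Hypotheses (df1 : is_density f1 P1 Q) (df2 : is_density f2 P2 Q).

Let mf1 : measurable_fun [set: T] f1. Proof. by have [] := df1. Qed.
Let mf2 : measurable_fun [set: T] f2. Proof. by have [] := df2. Qed.
Let f10 x : (0 <= f1 x)%R. Proof. by have [] := df1. Qed.
Let f20 x : (0 <= f2 x)%R. Proof. by have [] := df2. Qed.

Lemma density_integral1 (P P' : probability T R) f :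
  is_density f P P' -> \int[P']_x (f x)%:E = 1.
Proof. by move=> [_ _ <-] //; exact: probability_setT. Qed.

(** Three-term AM-GM, the product of the terms being (g b)^3. It follows from X + Y >= 2 s^3 with
    s^2 = g b, and 2 s^3 - 3 s^2 + 1 = (s - 1)^2 (2 s + 1). *)
Let amgm3 (k g b : R) : (0 < k)%R -> (0 <= g)%R -> (0 <= b)%R ->
  (3 * (g * b) <= k * (g * b * b) + k^-1 * (g ^+ 2 * b) + 1)%R.
Proof.
move=> k0 g0 b0; set X := (k * _)%R; set Y := (k^-1 * _)%R.
pose s := Num.sqrt (g * b).
have s0 : (0 <= s)%R by exact: sqrtr_ge0.
have sE : (s ^+ 2 = g * b)%R by rewrite sqr_sqrtr// mulr_ge0.
have X0 : (0 <= X)%R by rewrite !mulr_ge0// ltW.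
have ki : (0 <= k^-1)%R by rewrite invr_ge0 ltW.
have Y0 : (0 <= Y)%R by rewrite mulr_ge0// mulr_ge0// sqr_ge0.
have XY : (X * Y = s ^+ 6)%R.
  by rewrite (exprM s 2 3) sE /X /Y; field; rewrite gt_eqF.
have : (2 * s ^+ 3 <= X + Y)%R.
  have L0 : (0 <= 2 * s ^+ 3)%R by rewrite mulr_ge0// exprn_ge0.
  have R0 : (0 <= X + Y)%R by rewrite addr_ge0.
  rewrite -(@ler_pXn2r _ 2)//.
  have -> : ((2 * s ^+ 3) ^+ 2 = 4 * (X * Y))%R by rewrite XY; ring.
  by have := sqr_ge0 (X - Y); lra.
rewrite -sE.
have : (0 <= (s - 1) ^+ 2 * (2 * s + 1))%R.
  by rewrite mulr_ge0 ?sqr_ge0// addr_ge0// mulr_ge0.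
lra.
Qed.

(** Let g be the density of [P1] with respect to [P2]. Under [Q], g f2 has integral 1, g f2^2 has
    the overlap as its integral, and g^2 f2 integrates to at most 1 + D; integrating [amgm3] with k
    = 1 + D is then a form of Hoelder's inequality. *)
Lemma overlap_chi2 (D : R) : (0 <= D)%R -> chi2 P1 P2 <= D%:E ->
  1 <= (1 + D)%:E * \int[Q]_x (f1 x * f2 x)%:E.
Proof.
move=> D0 chiD.
have P12 : P1 `<< P2.
  by apply: contrapT => nP12; move: chiD; rewrite /chi2 asboolF.
have [g dg] := exists_density P12; have [mg g0 _] := dg.
set k := (1 + D)%R; have k0 : (0 < k)%R by rewrite ltr_wpDr.
have I1 : \int[Q]_x (g x * f2 x)%:E = 1.
  under eq_integral do rewrite EFinM.
  rewrite -(density_integral df2) ?(density_integral1 dg)//.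
  exact/measurable_EFinP.
have I2 : \int[Q]_x (g x * f2 x * f2 x)%:E = \int[Q]_x (f1 x * f2 x)%:E.
  under eq_integral do rewrite EFinM.
  rewrite -(density_integral df2); last 2 first.
    by apply/measurable_EFinP; exact: measurable_funM.
    by move=> x; rewrite lee_fin mulr_ge0.
  under eq_integral do rewrite mulrC EFinM.
  rewrite -(density_integral dg); last 2 first.
    exact/measurable_EFinP.
    by move=> x; rewrite lee_fin.
  rewrite (density_integral df1); last 2 first.
    exact/measurable_EFinP.
    by move=> x; rewrite lee_fin.
  by apply: eq_integral => x _; rewrite -EFinM mulrC.
have I3 : \int[Q]_x (g x ^+ 2 * f2 x)%:E <= k%:E.
  under eq_integral do rewrite EFinM.
  rewrite -(density_integral df2); last 2 first.
    by apply/measurable_EFinP; exact: measurable_funX.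
    by move=> x; rewrite lee_fin sqr_ge0.
  by rewrite -(chi2_density dg) /k EFinD [leRHS]addeC; exact: leeD2r.
have m1 : measurable_fun [set: T] (fun x => (g x * f2 x)%:E).
  by apply/measurable_EFinP; exact: measurable_funM.
have m2 : measurable_fun [set: T] (fun x => (g x * f2 x * f2 x)%:E).
  by apply/measurable_EFinP; apply: measurable_funM => //; exact: measurable_funM.
have m3 : measurable_fun [set: T] (fun x => (g x ^+ 2 * f2 x)%:E).
  by apply/measurable_EFinP; apply: measurable_funM => //; exact: measurable_funX.
have n1 x : 0 <= (g x * f2 x)%:E by rewrite lee_fin mulr_ge0.
have n2 x : 0 <= (g x * f2 x * f2 x)%:E by rewrite lee_fin !mulr_ge0.
have n3 x : 0 <= (g x ^+ 2 * f2 x)%:E by rewrite lee_fin mulr_ge0// sqr_ge0.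
have key : 3%:E * \int[Q]_x (g x * f2 x)%:E <=
    k%:E * \int[Q]_x (g x * f2 x * f2 x)%:E +
    k^-1%:E * \int[Q]_x (g x ^+ 2 * f2 x)%:E + \int[Q]_x cst 1 x.
  have ki : (0 <= k^-1)%R by rewrite invr_ge0 ltW.
  have kk : 0 <= k%:E by rewrite lee_fin ltW.
  rewrite -!ge0_integralZl//.
  rewrite -ge0_integralD//; last 4 first.
  - by move=> x _; rewrite mule_ge0.
  - exact: measurable_funeM.
  - by move=> x _; rewrite mule_ge0.
  - exact: measurable_funeM.
  rewrite -ge0_integralD//; last 2 first.
  - by move=> x _; rewrite adde_ge0// mule_ge0.
  - by apply: emeasurable_funD; exact: measurable_funeM.
  apply: ge0_le_integral => //.
  - by move=> x _; rewrite mule_ge0.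
  - exact: measurable_funeM.
  - apply: emeasurable_funD => //; apply: emeasurable_funD; exact: measurable_funeM.
  - by move=> x _; rewrite -!EFinM -!EFinD lee_fin; exact: amgm3.
move: key; rewrite I1 I2 mule1 prob_integral_cst => key.
have {}key : 3%:E <= k%:E * \int[Q]_x (f1 x * f2 x)%:E + 1 + 1.
  apply: le_trans key _; rewrite leeD2r// leeD2l//.
  apply: (@le_trans _ _ (k^-1%:E * k%:E)).
    by apply: lee_wpmul2l => //; rewrite lee_fin invr_ge0 ltW.
  by rewrite -EFinM mulVf ?gt_eqF.
move: key; case: (k%:E * _) => [z|_|]//; last exact: leey.
rewrite -!EFinD !lee_fin; lra.
Qed.

(** The witness is the Bhattacharyya affinity, the integral of sqrt(p q); Cauchy-Schwarz against the
    constant 1 under [Q] bounds its square by the overlap. *)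
Lemma hellinger2_overlap : exists b : R,
  [/\ (0 <= b)%R, hellinger2 P1 P2 = (2 - 2 * b)%:E &
      (b ^+ 2)%:E <= \int[Q]_x (f1 x * f2 x)%:E].
Proof.
pose PP (b : bool) := if b then P1 else P2.
pose mu := unif_mix true PP.
have muE A : mu A = (2^-1)%:E * (P1 A + P2 A).
  by rewrite /mu /unif_mix card_bool big_bool.
have dm : is_density (fun x => 2^-1 * (f1 x + f2 x))%R mu Q.
  split.
  - by apply: measurable_funM => //; exact: measurable_funD.
  - by move=> x; rewrite mulr_ge0// addr_ge0.
  - move=> A mA; apply: etrans (muE A) _.
    have [_ _ ->//] := df1; have [_ _ ->//] := df2.
    rewrite -ge0_integralD//; last 4 first.
    + by move=> x _; rewrite lee_fin.
    + by apply: measurable_funTS; exact/measurable_EFinP.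
    + by move=> x _; rewrite lee_fin.
    + by apply: measurable_funTS; exact/measurable_EFinP.
    rewrite -ge0_integralZl//.
    + by apply: emeasurable_funD; apply: measurable_funTS; exact/measurable_EFinP.
    + by move=> x _; rewrite adde_ge0 ?lee_fin.
set m := (fun x => _) in dm; have [mm m0 _] := dm.
have mu0 A : mu A = 0 -> P1 A = 0 /\ P2 A = 0.
  rewrite muE => /eqP; rewrite mule_eq0 eqe invr_eq0 pnatr_eq0 /=.
  by rewrite padde_eq0// => /andP[/eqP -> /eqP ->].
have P1mu : P1 `<< mu by apply/null_content_dominatesP => A _ /mu0[].
have P2mu : P2 `<< mu by apply/null_content_dominatesP => A _ /mu0[].
have [p dp] := exists_density P1mu; have [mp p0 pE] := dp.
have [q dq] := exists_density P2mu; have [mq q0 qE] := dq.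
have msqrt : measurable_fun [set: R] (@Num.sqrt R).
  by apply: continuous_measurable_fun; exact: sqrt_continuous.
have ms : measurable_fun [set: T] (fun x => Num.sqrt (p x * q x))%R.
  by apply: (measurableT_comp msqrt); exact: measurable_funM.
have dmul (P : probability T R) h : is_density h P mu ->
    is_density (fun x => h x * m x)%R P Q.
  move=> [mh h0 hE]; split.
  - exact: measurable_funM.
  - by move=> x; rewrite mulr_ge0.
  - move=> A mA; rewrite hE// integral_mkcond (density_integral dm); last 2 first.
    + apply/(measurable_restrictT _ _).1 => //.
      by apply: measurable_funTS; exact/measurable_EFinP.
    + by move=> x; rewrite patchE; case: ifPn => // _; rewrite lee_fin.
    rewrite [RHS]integral_mkcond; apply: eq_integral => x _.
    by rewrite !patchE; case: ifPn => _; rewrite ?mul0e// EFinM.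
have dpm := dmul _ _ dp; have dqm := dmul _ _ dq.
pose h2 x := ((Num.sqrt (p x) - Num.sqrt (q x)) ^+ 2)%R.
have mh2 : measurable_fun [set: T] h2.
  by apply: measurable_funX; apply: measurable_funB; exact: (measurableT_comp msqrt).
have HE : hellinger2 P1 P2 = \int[mu]_x (h2 x)%:E.
  have aep : ae_eq mu [set: T] (EFin \o p) ('d (charge_of_finite_measure P1) '/d mu).
    apply: (density_ae_eq dp) => // A mA.
    by rewrite -Radon_Nikodym_integral.
  have aeq : ae_eq mu [set: T] (EFin \o q) ('d (charge_of_finite_measure P2) '/d mu).
    apply: (density_ae_eq dq) => // A mA.
    by rewrite -Radon_Nikodym_integral.
  rewrite /hellinger2; apply: ae_eq_integral => //.
  - apply/measurable_EFinP; apply: measurable_funX; apply: measurable_funB.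
      by apply: (measurableT_comp msqrt); exact: measurableT_comp.
    by apply: (measurableT_comp msqrt); exact: measurableT_comp.
  - exact/measurable_EFinP.
  - apply: filterS2 aep aeq => x /(_ I) /= Hp /(_ I) /= Hq _.
    by rewrite -Hp -Hq.
have h20 x : 0 <= (h2 x)%:E by rewrite lee_fin sqr_ge0.
have s0 x : 0 <= (Num.sqrt (p x * q x))%:E by rewrite lee_fin sqrtr_ge0.
have sumE : \int[mu]_x (h2 x)%:E + 2%:E * \int[mu]_x (Num.sqrt (p x * q x))%:E = 2%:E.
  rewrite -ge0_integralZl//; last exact/measurable_EFinP.
  rewrite -ge0_integralD//; last 2 first.
  - exact/measurable_EFinP.
  - by apply: measurable_funeM; exact/measurable_EFinP.
  transitivity (\int[mu]_x ((p x)%:E + (q x)%:E)).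
    apply: eq_integral => x _; rewrite -EFinM -!EFinD; congr EFin.
    rewrite /h2 sqrtrM// sqrrB !sqr_sqrtr//.
    by set u := Num.sqrt (p x); set v := Num.sqrt (q x); ring.
  rewrite ge0_integralD//; last 4 first.
  - by move=> x _; rewrite lee_fin.
  - exact/measurable_EFinP.
  - by move=> x _; rewrite lee_fin.
  - exact/measurable_EFinP.
  by rewrite (density_integral1 dp) (density_integral1 dq).
have I0 : 0 <= \int[mu]_x (h2 x)%:E by exact: integral_ge0.
have J0 : 0 <= \int[mu]_x (Num.sqrt (p x * q x))%:E by exact: integral_ge0.
have [b bE] : exists b : R, \int[mu]_x (Num.sqrt (p x * q x))%:E = b%:E.
  move: sumE I0 J0; case: (\int[mu]_x (Num.sqrt _)%:E) => [z| |]//.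
    by exists z.
  move=> + I0 _.
  by rewrite gt0_muley ?lte_fin// addey// gt_eqF// (lt_le_trans _ I0)// ltNy0.
have b0 : (0 <= b)%R by rewrite -lee_fin -bE.
exists b; split => //.
  move: sumE I0; rewrite HE bE; case: (\int[mu]_x (h2 x)%:E) => [z| |]//.
  by rewrite -EFinM -EFinD => /(congr1 fine)/= zb _; congr EFin; lra.
(* The densities [p m] and [q m] replace [f1] and [f2] one at a time, through integrals under [P1]
   and [P2]; no almost everywhere identity is invoked. *)
have -> : \int[Q]_x (f1 x * f2 x)%:E = \int[Q]_x (p x * m x * (q x * m x))%:E.
  transitivity (\int[P1]_x (f2 x)%:E).
    rewrite (density_integral df1); last 2 first.
      exact/measurable_EFinP.
      by move=> x; rewrite lee_fin.
    by apply: eq_integral => x _; rewrite -EFinM mulrC.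
  rewrite (density_integral dpm); last 2 first.
    exact/measurable_EFinP.
    by move=> x; rewrite lee_fin.
  transitivity (\int[P2]_x (p x * m x)%:E).
    rewrite (density_integral df2); last 2 first.
      by apply/measurable_EFinP; exact: measurable_funM.
      by move=> x; rewrite lee_fin mulr_ge0.
    by apply: eq_integral => x _; rewrite -!EFinM mulrC.
  rewrite (density_integral dqm)//.
    by apply/measurable_EFinP; exact: measurable_funM.
  by move=> x; rewrite lee_fin mulr_ge0.
have bQ : \int[Q]_x (Num.sqrt (p x * q x) * m x)%:E = b%:E.
  rewrite -bE (density_integral dm)//.
  exact/measurable_EFinP.
set K := \int[Q]_x _.
(* Cauchy-Schwarz in the form 2 b y <= y^2 + b^2, with y = sqrt(p q) m and b the integral of y. *)
have key : (2 * b)%:E * \int[Q]_x (Num.sqrt (p x * q x) * m x)%:E <=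
    K + \int[Q]_x cst (b ^+ 2)%:E x.
  have mK : measurable_fun [set: T] (fun x => (p x * m x * (q x * m x))%:E).
    by apply/measurable_EFinP; apply: measurable_funM; exact: measurable_funM.
  have msm : measurable_fun [set: T] (fun x => (Num.sqrt (p x * q x) * m x)%:E).
    by apply/measurable_EFinP; exact: measurable_funM.
  have nsm x : 0 <= (Num.sqrt (p x * q x) * m x)%:E.
    by rewrite lee_fin mulr_ge0// sqrtr_ge0.
  have nK x : 0 <= (p x * m x * (q x * m x))%:E.
    by rewrite lee_fin; apply: mulr_ge0; exact: mulr_ge0.
  have b20 : 0 <= (2 * b)%:E by rewrite lee_fin mulr_ge0.
  have bb0 : 0 <= (b ^+ 2)%:E by rewrite lee_fin sqr_ge0.
  rewrite -ge0_integralZl// -ge0_integralD//.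
  apply: ge0_le_integral => //.
  - by move=> x _; rewrite mule_ge0.
  - exact: measurable_funeM.
  - exact: emeasurable_funD.
  - move=> x _; rewrite -EFinM -EFinD lee_fin.
    have pq0 : (0 <= p x * q x)%R by exact: mulr_ge0.
    have -> : (p x * m x * (q x * m x) = (Num.sqrt (p x * q x) * m x) ^+ 2)%R.
      by rewrite exprMn sqr_sqrtr//; ring.
    by have := sqr_ge0 (Num.sqrt (p x * q x) * m x - b); lra.
move: key; rewrite bQ prob_integral_cst -EFinM.
case: K => [z|_|]//; last exact: leey.
by rewrite -EFinD !lee_fin; lra.
Qed.

End overlap.

Lemma dominates_unif_mix d (T : measurableType d) (R : realType) (I : finType)
  (i0 : I) (P : I -> probability T R) i : P i `<< unif_mix i0 P.
Proof.
apply/null_content_dominatesP => A mA.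
rewrite /= /unif_mix => /eqP; rewrite mule_eq0 eqe invr_eq0 pnatr_eq0.
have /negPf -> /= : #|I| != 0%N by rewrite -lt0n; apply/card_gt0P; exists i.
by rewrite (bigD1 i)//= padde_eq0 ?sume_ge0// => /andP[/eqP].
Qed.

(** * Reduction of the divergence to a centered Gram matrix *)

Section reduction.
Context d (T : measurableType d) (R : realType) (n : nat) (n_gt0 : (0 < n.+1)%N).
Variables (P : 'I_n.+1 -> probability T R) (f : 'I_n.+1 -> T -> R).
Let N : R := n.+1%:R.
Let Q := unif_mix (Ordinal n_gt0) P.
Hypothesis df : forall i, is_density (f i) (P i) Q.

Let mf i : measurable_fun [set: T] (f i). Proof. by have [] := df i. Qed.
Let f0 i x : (0 <= f i x)%R. Proof. by have [] := df i. Qed.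

Definition overlap i j : R := fine (\int[Q]_x (f i x * f j x)%:E).

(** [Q] is the average of the [P j], so the unit integral of [f i] under [Q] is the average of the
    overlaps. *)
Let sum_overlap i : \sum_j \int[Q]_x (f i x * f j x)%:E = N%:E.
Proof.
have E : \int[Q]_x (f i x)%:E = (N^-1)%:E * \sum_j \int[Q]_x (f i x * f j x)%:E.
  rewrite unif_mix_integral//; last 2 first.
    exact/measurable_EFinP.
    by move=> x; rewrite lee_fin.
  rewrite card_ord; congr (_ * _); apply: eq_bigr => j _.
  rewrite (density_integral (df j))//; first exact/measurable_EFinP.
  by move=> x; rewrite lee_fin.
have N0 : (N != 0)%R by rewrite pnatr_eq0.
by rewrite -[LHS]mul1e -(divff N0) EFinM -muleA -E (density_integral1 (df i)) mule1.
Qed.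

(** Finiteness is the point: an overlap is a term of a nonnegative sum with finite total, although
    no density is assumed square integrable. *)
Lemma overlapE i j : \int[Q]_x (f i x * f j x)%:E = (overlap i j)%:E.
Proof.
have I0 k : 0 <= \int[Q]_x (f i x * f k x)%:E.
  by apply: integral_ge0 => x _; rewrite lee_fin mulr_ge0.
rewrite fineK// ge0_fin_numE//; apply: (@le_lt_trans _ _ N%:E); last exact: ltry.
by rewrite -(sum_overlap i) (bigD1 j)//= leeDl// sume_ge0.
Qed.

Let overlap_sum i : (\sum_j overlap i j = N)%R.
Proof.
apply: EFin_inj; rewrite -sumEFin -(sum_overlap i).
by apply: eq_bigr => j _; rewrite overlapE.
Qed.

Let overlapC i j : overlap i j = overlap j i.
Proof. by congr fine; apply: eq_integral => x _; rewrite mulrC. Qed.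

(** The covariance matrix of the densities under [Q], where each has mean 1, divided by their
    number. *)
Definition overlap_mx : 'M[R]_n.+1 := \matrix_(i, j) ((overlap i j - 1) / N)%R.

Let int_ff i j : Q.-integrable [set: T] (fun x => (f i x * f j x)%:E).
Proof.
apply/integrableP; split.
  by apply/measurable_EFinP; exact: measurable_funM.
under eq_integral do rewrite gee0_abs ?lee_fin ?mulr_ge0//.
by rewrite overlapE ltry.
Qed.

Let int_f i : Q.-integrable [set: T] (fun x => (f i x)%:E).
Proof. exact: density_integrable (df i). Qed.

Let int_1 : Q.-integrable [set: T] (fun x => (1 : R)%:E).
Proof. exact: finite_measure_integrable_cst. Qed.

Let int_centered i j :
  Q.-integrable [set: T] (fun x => ((f i x - 1) * (f j x - 1))%:E) /\
  \int[Q]_x ((f i x - 1) * (f j x - 1))%:E = (overlap i j - 1)%:E.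
Proof.
have I1 := integrableB measurableT (int_ff i j) (int_f i).
have I2 := integrableB measurableT I1 (int_f j).
have I3 := integrableD measurableT I2 int_1.
have E : (fun x => ((f i x - 1) * (f j x - 1))%:E) =
    ((fun x => (f i x * f j x)%:E) \- (fun x => (f i x)%:E) \-
    (fun x => (f j x)%:E) \+ (fun x => (1 : R)%:E)).
  by apply/funext => x /=; rewrite -!EFinB -EFinD; congr EFin; ring.
split; first by rewrite E.
rewrite E integralD// integralB// integralB// overlapE.
rewrite (density_integral1 (df i)) (density_integral1 (df j)).
rewrite [X in _ + X](prob_integral_cst Q 1).
by rewrite -!EFinB -EFinD; congr EFin; ring.
Qed.

Lemma overlap_mx_psd : psd overlap_mx.
Proof.
split; first by apply/matrixP => i j; rewrite !mxE overlapC.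
move=> x.
have -> : ((x^T *m overlap_mx *m x) 0 0 =
    N^-1 * \sum_i \sum_j x i 0 * x j 0 * (overlap i j - 1))%R.
  rewrite mxE exchange_big mulr_sumr; apply: eq_bigr => j _.
  rewrite mxE mulr_suml mulr_sumr; apply: eq_bigr => i _.
  by rewrite !mxE; ring.
rewrite mulr_ge0 ?invr_ge0 ?ler0n// -lee_fin.
have -> : (\sum_i \sum_j x i 0 * x j 0 * (overlap i j - 1))%:E =
    \int[Q]_t ((\sum_i x i 0 * (f i t - 1)) ^+ 2)%:E :> \bar R.
  transitivity (\int[Q]_t (\sum_i \sum_j
      (x i 0 * x j 0)%:E * ((f i t - 1) * (f j t - 1))%:E)); last first.
    apply: eq_integral => t _; rewrite expr2 mulr_suml -sumEFin.
    apply: eq_bigr => i _; rewrite mulr_sumr -sumEFin; apply: eq_bigr => j _.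
    by rewrite -EFinM; congr EFin; ring.
  have iZ i j : Q.-integrable [set: T]
      (fun t => (x i 0 * x j 0)%:E * ((f i t - 1) * (f j t - 1))%:E).
    by apply: integrableZl => //; exact: (int_centered i j).1.
  rewrite integral_sum//; last first.
    by move=> i; apply: integrable_sum => // j _; exact: iZ.
  rewrite -sumEFin; apply: eq_bigr => i _.
  rewrite integral_sum// -sumEFin; apply: eq_bigr => j _.
  by rewrite integralZl ?(int_centered i j).2//; exact: (int_centered i j).1.
by apply: integral_ge0 => t _; rewrite lee_fin sqr_ge0.
Qed.

Lemma overlap_mx_row i : (\sum_j overlap_mx i j = 0)%R.
Proof.
under eq_bigr do rewrite mxE.
rewrite -mulr_suml sumrB overlap_sum sumr_const card_ord -/N.
by rewrite subrr mul0r.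
Qed.

Lemma overlap_mxE i j : (1 + N * overlap_mx i j = overlap i j)%R.
Proof. by rewrite mxE mulrC mulfVK ?pnatr_eq0// addrC subrK. Qed.

(** The inner sum over the second permutation is the same for every first one, so the double sum is
    n! times a permanent, with n standing for the number of distributions. *)
Lemma chi2_perm_mixture :
  chi2 (perm_mixture P) (iid_mixture P n_gt0) = (perm_ratio overlap_mx - 1)%:E.
Proof.
have f1 : (n.+1`!%:R != 0 :> R)%R by rewrite pnatr_eq0 -lt0n fact_gt0.
have N0 : (N != 0)%R by rewrite pnatr_eq0.
have := perm_mixture_chi2 df overlapE.
suff -> : (n.+1`!%:R ^- 2 * (\sum_(s : 'S_n.+1) \sum_(u : 'S_n.+1)
    \prod_i overlap (s i) (u i)) = perm_ratio overlap_mx)%R.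
  move=> E; rewrite EFinB -E addeK//.
transitivity (n.+1`!%:R^-1 * \sum_(u : 'S_n.+1) \prod_i overlap i (u i))%R.
  rewrite (eq_bigr (fun=> \sum_(u : 'S_n.+1) \prod_i overlap i (u i))%R).
    rewrite sumr_const card_Sn -[X in (_ * X)%R]mulr_natl mulrA expr2 invfM.
    by rewrite mulfVK.
  move=> s _; rewrite (reindex_inj (mulgI s)) /=.
  apply: eq_bigr => u _; rewrite [RHS](reindex_inj (@perm_inj _ s)) /=.
  by apply: eq_bigr => i _; rewrite permM.
rewrite /perm_ratio mulrAC -/N mulrC; congr (_ / _)%R.
have -> : (N ^+ n.+1 = \prod_(i < n.+1) N)%R by rewrite prodr_const card_ord.
rewrite /permanent mulr_sumr; apply: eq_bigr => u _; rewrite -big_split /=.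
by apply: eq_bigr => i _; rewrite -overlap_mxE mulrDr divff.
Qed.

(** The trace is the average of chi^2(P_i || Q), which the uniform prior compares with the
    capacity. *)
Lemma overlap_mx_trace (F : set (probability T R)) : (forall i, F (P i)) ->
  (\tr overlap_mx)%:E <= chi2_capacity F.
Proof.
move=> FP; apply: le_trans (avg_chi2_le_capacity FP df (fun i => overlapE i i)).
rewrite lee_fin card_ord mulr_sumr le_eqVlt; apply/orP; left; apply/eqP.
by apply: eq_bigr => i _; rewrite mxE mulrC.
Qed.

End reduction.

(** * Range of the Hellinger divergence and derivation of the three bounds *)

Lemma hellinger2_ge0 d (T : measurableType d) (R : realType)
  (P1 P2 : probability T R) : 0 <= hellinger2 P1 P2.
Proof. by apply: integral_ge0 => x _; rewrite lee_fin sqr_ge0. Qed.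

Lemma hellinger2_le2 d (T : measurableType d) (R : realType)
  (P1 P2 : probability T R) : hellinger2 P1 P2 <= 2%:E.
Proof.
pose P b := if b then P1 else P2.
have [f1 df1] := exists_density (@dominates_unif_mix _ _ _ _ true P true).
have [f2 df2] := exists_density (@dominates_unif_mix _ _ _ _ true P false).
by have [b [b0 -> _]] := hellinger2_overlap df1 df2; rewrite lee_fin; lra.
Qed.

Lemma powR_expR (R : realType) (x y : R) : (0 < x)%R -> (x `^ y = expR (y * ln x))%R.
Proof. by move=> x0; rewrite /powR gt_eqF. Qed.

Theorem theorem1p2 (R : realType) (d : measure_display) (T : measurableType d)
    (F : set (probability T R)) (n : nat) (n_ge1 : (1 <= n)%N)
    (P : 'I_n -> probability T R) (FP : forall i, F (P i)) :
  let C := chi2_capacity F in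
  let D := chi2_diameter F in
  let Delta := hellinger2_singularity F in
  let chi2_PQ := chi2 (perm_mixture P) (iid_mixture P n_ge1) in
  [/\ C < +oo ->
        chi2_PQ <= 10%:R%:E * \sum_(2 <= l < n.+1) C ^+ l,
      Delta < +oo -> C < +oo ->
        chi2_PQ <= ((expR 1)%:E * Delta) `^ (fine C) - 1
    & D < +oo ->
        chi2_PQ <= (1 + D) `^ (1 + fine C)%R - 1].
Proof.
case: n n_ge1 P FP => // n n_ge1 P FP /=.
pose Q := unif_mix (Ordinal n_ge1) P.
have PQ i : P i `<< Q by exact: dominates_unif_mix.
pose f i := sval (cid (exists_density (PQ i))).
have df i : is_density (f i) (P i) Q by rewrite /f; case: cid.
rewrite (chi2_perm_mixture df); set B := overlap_mx _ _ _.
have psdB : psd B := overlap_mx_psd df.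
have B0 i : (\sum_j B i j = 0)%R := overlap_mx_row df i.
have trB := overlap_mx_trace df FP; rewrite -/B in trB.
have trB0 : (0 <= \tr B)%R by exact: (psd_tr_ge0 1 psdB).
set C := chi2_capacity F.
have C0 : 0 <= C by apply: le_trans trB; rewrite lee_fin.
have Cfin : C < +oo -> exists2 c : R, C = c%:E & (\tr B <= c)%R.
  move=> Coo; have Cf : C \is a fin_num by rewrite ge0_fin_numE.
  by exists (fine C); rewrite ?fineK// -lee_fin fineK.
have dd i j (b : R) : (b%:E <= \int[Q]_x (f i x * f j x)%:E) ->
    (b <= 1 + n.+1%:R * B i j)%R.
  by rewrite overlap_mxE -lee_fin -overlapE.
split.
- move=> /Cfin[c -> tc].
  have -> : \sum_(2 <= l < n.+2) c%:E ^+ l = (\sum_(2 <= l < n.+2) c ^+ l)%:E.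
    by rewrite -sumEFin; apply: eq_bigr => l _; rewrite EFin_expe.
  rewrite -EFinM lee_fin lerBlDl.
  apply: le_trans (perm_ratio_le psdB B0) _.
  rewrite lerD2l ler_wpM2l// ler_sum// => l _.
  by rewrite lerXn2r// nnegrE (le_trans trB0).
- move=> Delta_fin /Cfin[c -> tc] /=.
  have Hle P1 P2 : F P1 -> F P2 -> hellinger2 P1 P2 <= hellinger2_diameter F.
    by move=> F1 F2; apply: ereal_sup_ubound; exists (P1, P2).
  have H0 : 0 <= hellinger2_diameter F.
    by apply: le_trans (Hle _ _ (FP ord0) (FP ord0)); exact: hellinger2_ge0.
  have H2 : hellinger2_diameter F <= 2%:E.
    by apply: ge_ereal_sup => _ [[P1 P2] _ <-]; exact: hellinger2_le2.
  have [h hE] : exists h : R, hellinger2_diameter F = h%:E.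
    exists (fine (hellinger2_diameter F)).
    by rewrite fineK// ge0_fin_numE// (le_lt_trans H2)// ltry.
  move: Delta_fin; rewrite /hellinger2_singularity.
  move: Hle H0 H2; rewrite hE !lee_fin => Hle h0 h2.
  have -> : 1 - h%:E / 2%:E = (1 - h / 2)%:E.
    by rewrite inver [X in if X then _ else _]pnatr_eq0 -EFinM -EFinB.
  set b := (1 - h / 2)%R.
  have b0 : (0 <= b)%R by rewrite /b; lra.
  have b1 : (b <= 1)%R by rewrite /b; lra.
  (* Diameter 2 means [b = 0], where the singularity is infinite; the finiteness hypothesis excludes
     this. *)
  rewrite inver; case: eqP => [_|/eqP bn0 _]; first by rewrite expe2 mulyy.
  have {bn0}b0 : (0 < b)%R by rewrite lt_neqAle eq_sym bn0.
  have d0 : (0 < b ^+ 2)%R by rewrite exprn_gt0.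
  have d1 : (b ^+ 2 <= 1)%R by rewrite expr_le1// ltW.
  rewrite -EFin_expe -EFinM poweR_EFin -EFinB lee_fin lerD2r.
  (* The overlaps are at least d = b^2, the inverse of the singularity. Taking both exponents equal
     to tr B makes the condition on the trace an equality. *)
  apply: le_trans
    (@perm_ratio_le_expR _ _ _ (b ^+ 2) (\tr B) (\tr B) psdB B0 _ _ _ _) _ => //.
  + by rewrite d0.
  + move=> i j; apply: dd; have [b' [b'0 HE]] := hellinger2_overlap (df i) (df j).
    apply: le_trans; rewrite lee_fin lerXn2r ?nnegrE ?(ltW b0)//.
    by have := Hle _ _ (FP i) (FP j); rewrite HE lee_fin /b; lra.
  + by rewrite -mulrDr addrC subrK mulr1.
  (* A base of at least 1 allows the exponent tr B to be raised to the capacity. *)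
  have e1 : (1 <= expR 1 * b^-1 ^+ 2)%R.
    rewrite -[1%R]mulr1 ler_pM//; first by rewrite -[leLHS]expR0 ler_expR.
    by rewrite exprVn invf_ge1.
  have -> : (\tr B - \tr B * ln (b ^+ 2) = \tr B * ln (expR 1 * b^-1 ^+ 2))%R.
    rewrite lnM ?posrE ?expR_gt0 ?exprn_gt0 ?invr_gt0// expRK exprVn lnV ?posrE//.
    by ring.
  by rewrite -powR_expR ?(lt_le_trans _ e1)// ler_powR.
- move=> Doo; have Fne : F !=set0 by exists (P ord0).
  (* A finite diameter makes the capacity finite, so that [fine] does not alter its value. *)
  have CD := capacity_le_diameter Fne Doo.
  have [c CE tc] := Cfin (le_lt_trans CD Doo).
  rewrite CE /=; rewrite -/C CE in CD.
  set D := chi2_diameter F in Doo CD *.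
  have Df : D \is a fin_num.
    by rewrite ge0_fin_numE// (le_trans _ CD)// lee_fin (le_trans trB0).
  have [D' DE] : exists D' : R, D = D'%:E by exists (fine D); rewrite fineK.
  rewrite DE lee_fin in CD; rewrite DE -[1 + D'%:E]EFinD poweR_EFin -EFinB lee_fin lerD2r.
  have D0 : (0 <= D')%R by rewrite (le_trans _ CD)// (le_trans trB0).
  have D1 : (0 < 1 + D')%R by rewrite ltr_wpDr.
  (* Here d = 1 / (1 + D) by [overlap_chi2]. The exponents 0 and 1 + tr B are admissible exactly
     when tr B <= D, which follows from tr B <= C <= D. *)
  apply: le_trans
    (@perm_ratio_le_expR _ _ _ ((1 + D')^-1) 0 (1 + \tr B) psdB B0 _ _ _ _) _ => //.
  + by rewrite invr_gt0 D1 invf_le1// lerDl.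
  + move=> i j; apply: dd; rewrite -(mul1r (_^-1)%R) mulrC EFinM.
    rewrite lee_pdivrMl//; apply: (overlap_chi2 (df i) (df j)) => //.
    by rewrite -DE; apply: ereal_sup_ubound; exists (P i, P j) => //; split; exact: FP.
  + rewrite mul0r add0r.
    have -> : ((1 + \tr B) * (1 - (1 + D')^-1) = \tr B + (D' - \tr B) / (1 + D'))%R.
      by field; rewrite gt_eqF.
    by rewrite lerDl divr_ge0 ?(ltW D1)// subr_ge0 (le_trans tc).
  rewrite lnV ?posrE// sub0r mulrN opprK -powR_expR//.
  by rewrite ler_powR// ?lerDl// lerD2l.
Qed.
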